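(* Let $\mathcal M$ be a smooth manifold, let $g=(g^1,\dots,g^m)\colon\mathcal M\to\mathbb R^m$ and $h=(h^1,\dots,h^q)\colon\mathcal M\to\mathbb R^q$ be of class $C^1$, let $\Omega=\{p\in\mathcal M: g(p)\le 0,\ h(p)=0\}$ and suppose $p\in\Omega$. Let $\mathcal F(p)$ be the set of $C^1$-functions $f\colon\mathcal M\to\mathbb R$ such that $p$ is a local minimizer of $f$ over $\Omega$, and for $f\in\mathcal F(p)$ let $\Lambda(f;p)\subseteq\mathbb R_m\times\mathbb R_q$ be the set of Lagrange multipliers $(\mu,\lambda)$ satisfying the KKT conditions at $p$. Then: (a) The set $\Lambda(f;p)$ is non-empty for all $f\in\mathcal F(p)$ if and only if GCQ holds at $p$. (b) If MFCQ holds at $p$, then $\Lambda(f;p)$ is compact for all $f\in\mathcal F(p)$. (c) If $\Lambda(f;p)$ is non-empty and compact for some $f\in\mathcal F(p)$, then MFCQ holds at $p$. (d) The set $\Lambda(f;p)$ is a singleton for all $f\in\mathcal F(p)$ if and only if LICQ holds at $p$.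
   Context: A smooth manifold is a Hausdorff, second-countable space with a smooth ($C^\infty$) atlas of dimension $n$. Inequalities between vectors are componentwise; $\mathbb R_m,\mathbb R_q$ are spaces of row vectors. $p\in\Omega$ is a local minimizer of $f$ over $\Omega$ if there is a neighborhood $U$ of $p$ with $f(p)\le f(x)$ for all $x\in U\cap\Omega$. Tangent vectors at $p$ are those generated by $C^1$-curves $\gamma\colon(-\varepsilon,\varepsilon)\to\mathcal M$ with $\gamma(0)=p$; such a curve generates $[\dot\gamma(0)]$, acting on $C^1$-functions $s$ defined near $p$ by $[\dot\gamma(0)](s)=\frac{\mathrm d}{\mathrm dt}(s\circ\gamma)|_{t=0}$. They form the $n$-dimensional tangent space $\mathcal T_p\mathcal M$, with dual $\mathcal T_p^*\mathcal M$; the differential of $s$ at $p$ is $(\mathrm ds)(p)\,\xi=\xi(s)$. The active set is $\mathcal A(p)=\{i\in\{1,\dots,m\}: g^i(p)=0\}$. KKT conditions at $p$ for $(\mu,\lambda)$: $(\mathrm df)(p)+\sum_{i=1}^m\mu_i(\mathrm dg^i)(p)+\sum_{j=1}^q\lambda_j(\mathrm dh^j)(p)=0$, $h(p)=0$, $\mu\ge 0$, $g(p)\le 0$, $\mu\,g(p)=0$. (Bouligand) tangent cone: $\mathcal T(\Omega;p)$ is the set of all $\xi\in\mathcal T_p\mathcal M$ for which there exist sequences $(p_k)\subseteq\Omega$ and $t_k\searrow 0$ (with $t_k>0$) such that for all $C^1$-functions $s$ defined near $p$, $\xi(s)=\lim_{k\to\infty}\frac{s(p_k)-s(p)}{t_k}$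 (in particular $p_k\to p$, so that $s(p_k)$ is defined for large $k$). Linearizing cone: $\mathcal L(\Omega;p)=\{\xi\in\mathcal T_p\mathcal M:\ \xi(g^i)\le 0\ \forall i\in\mathcal A(p),\ \xi(h^j)=0\ \forall j=1,\dots,q\}$. Polar cone of $B\subseteq\mathcal T_p\mathcal M$: $B^\circ=\{\sigma\in\mathcal T_p^*\mathcal M:\ \sigma\,\xi\le 0\ \forall\xi\in B\}$. Constraint qualifications at $p$: LICQ: $\{(\mathrm dh^j)(p)\}_{j=1}^q\cup\{(\mathrm dg^i)(p)\}_{i\in\mathcal A(p)}$ is linearly independent (as a family) in $\mathcal T_p^*\mathcal M$. MFCQ: $\{(\mathrm dh^j)(p)\}_{j=1}^q$ is linearly independent (as a family) and there exists $\xi\in\mathcal T_p\mathcal M$ with $(\mathrm dg^i)(p)\,\xi<0$ for all $i\in\mathcal A(p)$ and $(\mathrm dh^j)(p)\,\xi=0$ for all $j=1,\dots,q$. GCQ: $\mathcal L(\Omega;p)^\circ=\mathcal T(\Omega;p)^\circ$. *)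

(* Defs.v *)
From HB Require Import structures.
From mathcomp Require Import all_boot all_order all_algebra.
From mathcomp Require Import all_classical all_reals all_analysis.
Set Implicit Arguments.
Unset Strict Implicit.
Unset Printing Implicit Defensive.
Import Order.TTheory GRing.Theory Num.Theory.
Import numFieldNormedType.Exports.
Local Open Scope classical_set_scope.
Local Open Scope ring_scope.

(* [f] has continuous partial derivatives of all orders up to [k] at the points
   of [U]; only meaningful when [U] is open. *)
Fixpoint Ck_on (R : realType) (n k : nat) (U : set 'rV[R]_n)
    (f : 'rV[R]_n -> R) : Prop :=
  (forall x, U x -> {for x, continuous f}) /\
  (if k is k'.+1 then
     forall i : 'I_n,
       (forall x, U x -> derivable f x (delta_mx ord0 i)) /\
       Ck_on k' U (fun x => 'D_(delta_mx ord0 i) f x)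
   else True).

(* A homeomorphism from the open set [chart_dom] onto an open subset of R^n.
   The chart and its inverse are total functions; only their values on
   [chart_dom] and [chart_img], respectively, are meaningful. *)
Record chart (R : realType) (n : nat) (T : topologicalType) := Chart {
  chart_dom : set T;
  chart_map :> T -> 'rV[R]_n;
  chart_inv : 'rV[R]_n -> T;
  chart_dom_open : open chart_dom;
  chart_img_open : open (chart_map @` chart_dom);
  chart_mapK : forall x, chart_dom x -> chart_inv (chart_map x) = x;
  chart_map_cont : forall x, chart_dom x -> {for x, continuous chart_map};
  chart_inv_cont : forall y, (chart_map @` chart_dom) y ->
    {for y, continuous chart_inv} }.

Definition smooth_compatible (R : realType) (n : nat) (T : topologicalType)
    (c d : chart R n T) : Prop :=
  forall (k : nat) (i : 'I_n),
    Ck_on k (c @` (chart_dom c `&` chart_dom d))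
      (fun y => d (chart_inv c y) ord0 i).

Record smooth_manifold (R : realType) (n : nat) := SmoothManifold {
  manifold_space :> topologicalType;
  manifold_hausdorff : hausdorff_space manifold_space;
  manifold_second_countable : @second_countable manifold_space;
  atlas : set (chart R n manifold_space);
  atlas_cover : forall x, exists2 c, atlas c & chart_dom c x;
  atlas_compatible : forall c d, atlas c -> atlas d -> smooth_compatible c d }.

Section Manifold.
Context {R : realType} {n : nat} {M : smooth_manifold R n}.

Definition C1_on (V : set M) (s : M -> R) : Prop :=
  forall c, atlas c -> Ck_on 1 (c @` (chart_dom c `&` V)) (s \o chart_inv c).

Record C1fun := MkC1fun {
  C1fun_fun :> M -> R;
  C1funP : C1_on setT C1fun_fun }.

Record C1map (m : nat) := MkC1map {
  C1map_fun :> M -> 'cV[R]_m;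
  C1mapP : forall i, C1_on setT (fun x => C1map_fun x i ord0) }.

Definition component (m : nat) (g : C1map m) (i : 'I_m) : C1fun :=
  MkC1fun (C1mapP g i).

(* A C^1-function defined near [p] is an arbitrary total extension of it. *)
Record C1near (p : M) := MkC1near {
  C1near_fun :> M -> R;
  C1nearP : exists V : set M, [/\ open V, V p & C1_on V C1near_fun] }.

Definition C1fun_near (p : M) (f : C1fun) : C1near p :=
  MkC1near (ex_intro _ setT (And3 openT (I : setT p) (C1funP f))).

(* [gamma] is a C^1-curve on ]-e, e[ through [p]; it is a total function whose
   values outside ]-e, e[ are irrelevant. *)
Definition C1_curve (p : M) (e : R) (gamma : R -> M) : Prop :=
  [/\ 0 < e, gamma 0 = p,
      forall t, -e < t < e -> {for t, continuous gamma} &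
      forall c, atlas c -> forall t, -e < t < e -> chart_dom c (gamma t) ->
        forall i : 'I_n,
          derivable (fun u => c (gamma u) ord0 i) t 1 /\
          {for t, continuous (derive1 (fun u => c (gamma u) ord0 i))} ].

Definition velocity (p : M) (gamma : R -> M) : C1near p -> R :=
  fun s => derive1 (s \o gamma) 0.

(* The tangent space at [p]: a set of functionals on the C^1-functions defined
   near [p]; its vector space operations are the pointwise ones. *)
Record tangent (p : M) := MkTangent {
  tangent_fun :> C1near p -> R;
  tangentP : exists (e : R) (gamma : R -> M),
    C1_curve p e gamma /\ tangent_fun = velocity gamma }.

(* The dual of the tangent space, as a set of functions on the tangent space. *)
Definition cotangent (p : M) : set (tangent p -> R) :=
  [set sigma | forall (a : R) (xi eta zeta : tangent p),
     zeta = a *: (xi : C1near p -> R) + eta :> (C1near p -> R) ->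
     sigma zeta = a * sigma xi + sigma eta].

Definition differential (p : M) (s : C1near p) : tangent p -> R :=
  fun xi => xi s.

Definition polar (p : M) (B : set (tangent p)) : set (tangent p -> R) :=
  [set sigma | cotangent sigma /\ forall xi, B xi -> sigma xi <= 0].

Definition tangent_cone (Omega : set M) (p : M) : set (tangent p) :=
  [set xi | exists (pk : nat -> M) (tk : nat -> R),
     [/\ forall k, Omega (pk k),
         pk k @[k --> \oo] --> p,
         (forall k, 0 < tk k) /\ tk k @[k --> \oo] --> 0 &
         forall s : C1near p,
           (s (pk k) - s p) / tk k @[k --> \oo] --> xi s] ].

Definition local_minimizer (Omega : set M) (f : M -> R) (p : M) : Prop :=
  Omega p /\
  exists2 U, nbhs p U & forall x, (U `&` Omega) x -> f p <= f x.

Definition lin_independent (I : finType) (V : lmodType R) (v : I -> V) : Prop :=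
  forall a : I -> R, \sum_i a i *: v i = 0 -> forall i, a i = 0.

Section Constraints.
Context {m q : nat} (g : C1map m) (h : C1map q).

Definition feasible : set M :=
  [set x | (forall i, g x i ord0 <= 0) /\ h x = 0].

Definition dg (p : M) (i : 'I_m) : tangent p -> R :=
  differential (C1fun_near p (component g i)).

Definition dh (p : M) (j : 'I_q) : tangent p -> R :=
  differential (C1fun_near p (component h j)).

Definition active (p : M) : pred 'I_m := fun i => g p i ord0 == 0.

Definition linearizing_cone (p : M) : set (tangent p) :=
  [set xi | (forall i, active p i -> dg i xi <= 0) /\
            (forall j, dh j xi = 0)].

Definition LICQ (p : M) : Prop :=
  lin_independent (fun k : 'I_q + {i : 'I_m | active p i} =>
    match k with inl j => dh (p := p) j | inr i => dg (val i) end).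

Definition MFCQ (p : M) : Prop :=
  lin_independent (dh (p := p)) /\
  exists xi : tangent p,
    (forall i, active p i -> dg i xi < 0) /\ (forall j, dh j xi = 0).

Definition GCQ (p : M) : Prop :=
  polar (linearizing_cone (p := p)) = polar (tangent_cone feasible (p := p)).

Definition minimized_at (p : M) : set C1fun :=
  [set f | local_minimizer feasible f p].

Definition multipliers (f : C1fun) (p : M) : set ('rV[R]_m * 'rV[R]_q) :=
  [set ml : 'rV[R]_m * 'rV[R]_q | let: (mu, lambda) := ml in
    [/\ differential (C1fun_near p f)
          + \sum_i mu ord0 i *: dg (p := p) i
          + \sum_j lambda ord0 j *: dh (p := p) j = 0,
        h p = 0,
        forall i, 0 <= mu ord0 i,
        forall i, g p i ord0 <= 0 &
        mu *m g p = 0] ].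

End Constraints.
End Manifold.

Arguments C1fun {R n} M.
Arguments C1map {R n} M m.

(* Main.v *)
(* In a chart around p, tangent vectors are the vectors v of R^n acting by the
   derivative along v, so KKT multipliers for f exist iff -df lies in the cone
   generated by the dg^i (i active) and the +-dh^j, which by Farkas' lemma is
   the polar of the linearizing cone.
   (a) If f is minimal at p then -df is in the polar of the tangent cone T.
   Conversely every sigma in that polar is -df for some f minimal at p: with
   h = x - p in the chart, compactness of the unit ball gives
   sigma(h) <= o(|h|) on Omega, and the o(|h|) is dominated by a C^1 function
   with vanishing derivative at 0; a bump function makes f global. So the
   multipliers always exist iff the polars of T and of the linearizing cone
   agree.
   (b) The vector in MFCQ bounds mu, and the independence of the dh^j then
   bounds lambda.
   (c) If MFCQ fails, Motzkin's alternative gives a nonzero direction in which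
   the set of multipliers is unbounded.
   (d) For f = -sum of the active g^i, the multiplier (1, 0) is positive on the
   active constraints, so uniqueness forces independence.  Conversely, under
   LICQ multipliers are obtained from a quadratic penalty, without the implicit
   function theorem: the penalty gradients converge because a dual family of
   the constraint differentials reads off their coefficients. *)
Require Import Defs.
From HB Require Import structures.
From mathcomp Require Import all_boot all_order all_algebra.
From mathcomp Require Import all_classical all_reals all_analysis.
From mathcomp Require Import ring lra.
Import numFieldNormedType.Exports.
Set Implicit Arguments.
Unset Strict Implicit.
Unset Printing Implicit Defensive.
Import Order.TTheory GRing.Theory Num.Theory.
Local Open Scope classical_set_scope.
Local Open Scope ring_scope.

(** * Continuously differentiable functions on R^n *)

Section Calculus.
Context {R : realType}.

Lemma near_open (T : topologicalType) (U : set T) (P : T -> Prop) x :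
  open U -> U x -> (forall y, U y -> P y) -> \forall y \near x, P y.
Proof. by move=> oU Ux UP; apply: filterS (open_nbhs_nbhs (conj oU Ux)). Qed.

Lemma continuous_at_eq_open (T W : topologicalType) (U : set T) (f g : T -> W) x :
  open U -> U x -> (forall y, U y -> f y = g y) ->
  {for x, continuous f} -> {for x, continuous g}.
Proof.
move=> oU Ux fg; rewrite /prop_for /continuous_at fg// => cf.
apply: cvg_trans cf; apply: near_eq_cvg.
by apply: (near_open oU Ux) => y Uy; rewrite fg.
Qed.

Lemma norm_coord_le n (v : 'rV[R]_n) i : `|v ord0 i| <= `|v|.
Proof.
by rewrite [leRHS]/Num.norm/= mx_normrE; apply: (le_bigmax _ _ (ord0, i)).
Qed.

Lemma norm_le_coord n (v : 'rV[R]_n) e :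
  0 <= e -> (forall i, `|v ord0 i| <= e) -> `|v| <= e.
Proof.
move=> e0 ve; rewrite [leLHS]/Num.norm/= mx_normrE.
by apply: bigmax_le => // -[i j] _ /=; rewrite ord1.
Qed.

Lemma cvg_sum_fin (I : finType) (T : Type) (F : set_system T) {FF : Filter F}
    (f : I -> T -> R) (a : I -> R) :
  (forall i, f i x @[x --> F] --> a i) ->
  \sum_i f i x @[x --> F] --> \sum_i a i.
Proof. by move=> fa; apply: cvg_big => //; exact: add_continuous. Qed.

Lemma continuous_at_sum (I : finType) (T : topologicalType) (f : I -> T -> R) x :
  (forall i, {for x, continuous (f i)}) ->
  {for x, continuous (fun y => \sum_i f i y)}.
Proof. by move=> cf; apply: cvg_sum_fin => i; exact: cf. Qed.

(** The candidate differential: linear in [v] by construction, it equals ['d f x] as soon as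
    [differentiable_partials] applies. *)
Definition dir_deriv n (f : 'rV[R]_n -> R) (x v : 'rV[R]_n) : R :=
  \sum_i v ord0 i * 'D_(delta_mx ord0 i) f x.

Lemma dir_deriv_is_linear n (f : 'rV[R]_n -> R) x : linear (dir_deriv f x).
Proof.
move=> a u v; rewrite /dir_deriv scaler_sumr -big_split/=.
by apply: eq_bigr => i _; rewrite !mxE mulrDl scalerAl.
Qed.

HB.instance Definition _ n (f : 'rV[R]_n -> R) x :=
  GRing.isLinear.Build R 'rV[R]_n R *:%R (dir_deriv f x) (dir_deriv_is_linear f x).

Lemma dir_deriv_scalar n (f : 'rV[R]_n -> R) x : scalar (dir_deriv f x).
Proof. exact: dir_deriv_is_linear. Qed.

Lemma dir_derivZ n (f : 'rV[R]_n -> R) x a v :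
  dir_deriv f x (a *: v) = a * dir_deriv f x v.
Proof. exact: linearZ. Qed.

Lemma dir_deriv_continuous n (f : 'rV[R]_n -> R) x : continuous (dir_deriv f x).
Proof.
move=> v; apply: (@cvg_sum_fin _ _ (nbhs v)) => i.
by apply: cvgM; [exact: coord_continuous|exact: cvg_cst].
Qed.

Lemma is_derive_line (V : normedModType R) (f : V -> R) z v t :
  derivable f (z + t *: v) v ->
  is_derive t 1 (fun u : R => f (z + u *: v)) ('D_v f (z + t *: v)).
Proof.
move=> df.
have E : (fun h : R => h^-1 *: (((fun u : R => f (z + u *: v)) \o shift t) (h *: (1 : R))
             - f (z + t *: v)))
  = (fun h => h^-1 *: ((f \o shift (z + t *: v)) (h *: v) - f (z + t *: v))).
  apply/funext => h /=; congr (_ *: (f _ - _)).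
  by rewrite [h *: 1]mulr1 scalerDl addrCA.
by split; rewrite /derivable /derive E.
Qed.

(** [s] may have either sign, so the mean value theorem is applied on [[0, s]] or on [[s, 0]]. *)
Lemma MVT_line (V : normedModType R) (f : V -> R) z v s :
  (forall t, `|t| <= `|s| -> derivable f (z + t *: v) v) ->
  exists2 t : R, `|t| <= `|s| & f (z + s *: v) - f z = s * 'D_v f (z + t *: v).
Proof.
move=> df.
pose g (u : R) := f (z + u *: v).
have dg (u : R) : `|u| <= `|s| -> is_derive u 1 g ('D_v f (z + u *: v)).
  by move=> us; exact/is_derive_line/df.
have cg (a b : R) : `|a| <= `|s| -> `|b| <= `|s| -> {within `[a, b], continuous g}.
  move=> sa sb; apply: derivable_within_continuous => u /[!in_itv]/= /andP[au ub].
  have us : `|u| <= `|s|.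
    move: sa sb; rewrite !ler_norml => /andP[a1 a2] /andP[b1 b2].
    by rewrite (le_trans a1 au) (le_trans ub b2).
  by have [] := dg u us.
have g0 : g 0 = f z by rewrite /g scale0r addr0.
have n0 : `|0 : R| <= `|s| by rewrite normr0.
have [s0|s0] := leP 0 s.
  have dg0 (u : R) : u \in `]0, s[ -> is_derive u 1 g ('D_v f (z + u *: v)).
    by rewrite in_itv/= => /andP[u0 us]; apply: dg; rewrite !ger0_norm// ltW.
  have [t] := MVT_segment s0 dg0 (cg 0 s n0 (lexx _)).
  rewrite in_itv/= => /andP[t0 ts] E; exists t; first by rewrite !ger0_norm.
  by rewrite -g0 -/(g s) E subr0 mulrC.
have dg0 (u : R) : u \in `]s, 0[ -> is_derive u 1 g ('D_v f (z + u *: v)).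
  by rewrite in_itv/= => /andP[u0 us]; apply: dg; rewrite !ler0_norm ?lerN2// ltW.
have [t] := MVT_segment (ltW s0) dg0 (cg s 0 (lexx _) n0).
rewrite in_itv/= => /andP[t0 ts] E; exists t.
  by rewrite !ler0_norm ?lerN2// ltW.
by rewrite -g0 -/(g s) -[LHS]opprB E sub0r mulrN opprK mulrC.
Qed.

(** Passing from [x] to [y] changes one coordinate at a time, and [MVT_line] applies to each move.
    In the maximum norm all intermediate points are at least as close to [x] as [y] is. *)
Lemma increment_partials n (f : 'rV[R]_n -> R) x r :
  (forall y, `|y - x| <= r -> forall i, derivable f y (delta_mx ord0 i)) ->
  forall y, `|y - x| <= r ->
  exists zeta : 'I_n -> 'rV[R]_n, (forall i, `|zeta i - x| <= `|y - x|) /\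
    f y - f x = \sum_i (y - x) ord0 i * 'D_(delta_mx ord0 i) f (zeta i).
Proof.
move=> df y yr.
(* [z k] has the first [k] coordinates of [y] and the others of [x], so [z 0 = x] and [z n = y]. *)
pose z k : 'rV[R]_n := \row_j (if (j < k)%N then y ord0 j else x ord0 j).
have zS (k : 'I_n) : z k.+1 = z k + (y - x) ord0 k *: delta_mx ord0 k.
  apply/rowP => j; rewrite !mxE/= ltnS leq_eqVlt.
  have [/val_inj->|jk]/= := eqVneq (val j) (val k).
    by rewrite ltnn eqxx mulr1 addrC subrK.
  by rewrite -val_eqE/= (negbTE jk) mulr0 addr0.
have zx (k : 'I_n) t : `|t| <= `|(y - x) ord0 k| ->
    `|z k + t *: delta_mx ord0 k - x| <= `|y - x|.
  move=> tk; apply: norm_le_coord => // j; rewrite !mxE.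
  have [->|jk] := eqVneq j k.
    by rewrite ltnn !eqxx mulr1 addrAC subrr add0r (le_trans tk)// norm_coord_le.
  rewrite andbF mulr0 addr0; case: ifP => _; last by rewrite subrr normr0.
  by rewrite (le_trans _ (norm_coord_le _ j))// !mxE.
have zeta (k : 'I_n) : exists w, `|w - x| <= `|y - x| /\
    f (z k.+1) - f (z k) = (y - x) ord0 k * 'D_(delta_mx ord0 k) f w.
  have [|t tk] := @MVT_line _ f (z k) (delta_mx ord0 k) ((y - x) ord0 k).
    by move=> t tk; apply: df; rewrite (le_trans _ yr)// zx.
  by rewrite -zS => E; exists (z k + t *: delta_mx ord0 k); split => //; exact: zx.
have [w wP] := choice zeta; exists w; split; first by move=> i; have [] := wP i.
have -> : f y - f x = f (z n) - f (z 0%N).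
  by congr (f _ - f _); apply/rowP => j; rewrite mxE ?ltn_ord.
rewrite -(telescope_sumr (fun k => f (z k)) (leq0n n)) big_mkord.
by apply: eq_bigr => i _; have [] := wP i.
Qed.

(** By [increment_partials] the remainder is a sum of coordinates of [h] times differences between
    partial derivatives at nearby points and at [x]; these differences are small by continuity. *)
Lemma differentiable_partials n (f : 'rV[R]_n -> R) x :
  (\forall y \near x, forall i, derivable f y (delta_mx ord0 i)) ->
  (forall i, {for x, continuous (fun y => 'D_(delta_mx ord0 i) f y)}) ->
  differentiable f x /\ 'd f x = dir_deriv f x :> ('rV[R]_n -> R).
Proof.
move=> df cf.
have E : f \o shift x = cst (f x) + dir_deriv f x +o_ 0 id.
  apply/eqaddoP => e e0.
  (* Dividing by [n.+1] also covers dimension 0; the surplus summand this creates below is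
     nonnegative and is dropped. *)
  have d0 : 0 < e / n.+1%:R by rewrite divr_gt0.
  have cf' : \forall y \near x, forall i : 'I_n,
      `|'D_(delta_mx ord0 i) f x - 'D_(delta_mx ord0 i) f y| < e / n.+1%:R.
    by apply: (filter_forall (nbhs_filter x)) => i; have /cvgrPdist_lt := cf i; exact.
  have [r /= r0 rP] := (nbhs_ballP x _).1 (filterI df cf').
  have xr y : `|y - x| <= r / 2 -> ball x r y.
    move=> yr; rewrite -ball_normE/= distrC (le_lt_trans yr)//.
    by rewrite ltr_pdivrMr// ltr_pMr// ltr1n.
  apply: (nbhs_ballP _ _).2; exists (r / 2); first by rewrite /= divr_gt0.
  move=> h; rewrite -ball_normE/= sub0r normrN => /ltW hr.
  have yx : h + x - x = h by rewrite addrK.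
  have dfr y : `|y - x| <= r / 2 -> forall i, derivable f y (delta_mx ord0 i).
    by move=> /xr /rP[].
  have hxr : `|h + x - x| <= r / 2 by rewrite yx.
  have [zeta [zx]] := increment_partials dfr hxr.
  rewrite yx => Ef; rewrite !fctE /= opprD addrA Ef -sumrB.
  apply: le_trans (ler_norm_sum _ _ _) _.
  have -> : e * `|h| = \sum_(i < n.+1) e / n.+1%:R * `|h|.
    by rewrite sumr_const card_ord -[RHS]mulr_natr mulrAC divfK// pnatr_eq0.
  rewrite big_ord_recr/= -[leLHS]addr0 lerD//; last first.
    by rewrite mulr_ge0// ltW.
  apply: ler_sum => i _; rewrite -mulrBr normrM mulrC ler_pM//.
    rewrite distrC ltW//; have /xr /rP[_] : `|zeta i - x| <= r / 2.
      by rewrite (le_trans (zx i))// yx.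
    by apply.
  exact: norm_coord_le.
have Ed := diff_unique (@dir_deriv_continuous n f x) E.
split => //; apply/diff_locallyP; rewrite Ed; split => //.
exact: dir_deriv_continuous.
Qed.

Lemma derivable_line0 (V : normedModType R) (f : V -> R) x v d :
  is_derive x v f d <-> is_derive (0 : R) 1 (fun h : R => f (h *: v + x)) d.
Proof.
split=> -[df <-].
  have := @is_derive_line _ f x v 0; rewrite scale0r addr0 => /(_ df).
  by under eq_fun do rewrite addrC.
have df' : derivable f x v by apply/derivable1P.
split => //; have := @is_derive_line _ f x v 0; rewrite scale0r addr0 => /(_ df')[_ <-].
by under eq_fun do rewrite addrC.
Qed.

Lemma is_derive_comp1 (V : normedModType R) (phi : R -> R) (f : V -> R) x v a b :
  is_derive (f x) 1 phi a -> is_derive x v f b ->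
  is_derive x v (phi \o f) (a * b).
Proof.
move=> dphi /derivable_line0 df; apply/derivable_line0.
by apply: is_derive1_comp df; rewrite scale0r add0r.
Qed.

(** Along the line [h *: v + x] the inner map is a curve, and in one real variable derivability is
    differentiability. Hence the coordinates of [tau] need a derivative in the direction [v]
    only. *)
Lemma is_derive_chain (V : normedModType R) k (f : 'rV[R]_k -> R)
    (tau : V -> 'rV[R]_k) x v (d : 'rV[R]_k) :
  differentiable f (tau x) -> 'd f (tau x) = dir_deriv f (tau x) :> (_ -> _) ->
  (forall j, is_derive x v (fun y => tau y ord0 j) (d ord0 j)) ->
  is_derive x v (f \o tau) (dir_deriv f (tau x) d).
Proof.
move=> df Ef dtau; apply/derivable_line0.
pose s (h : R) := tau (h *: v + x).
have s0 : s 0 = tau x by rewrite /s scale0r add0r.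
have dsj j : is_derive (0 : R) 1 (fun h => s h ord0 j) (d ord0 j).
  exact: (derivable_line0 _ _ _ _).1 (dtau j).
have ds : derivable s 0 1.
  by apply/derivable_mxP => i j; rewrite ord1; have [] := dsj j.
have Es : 'D_1 s 0 = d.
  rewrite derive_mx//; apply/rowP => j; rewrite mxE.
  by have [] := dsj j.
have sdiff : differentiable s 0 by apply/derivable1_diffP.
have fdiff : differentiable f (s 0) by rewrite s0.
have fs : differentiable (f \o s) 0 by exact: differentiable_comp.
split; first exact: diff_derivable.
have -> : (fun h : R => (f \o tau) (h *: v + x)) = f \o s by [].
by rewrite deriveE// diff_comp//= -[X in 'd f _ X]deriveE// Es s0 Ef.
Qed.

(** * Stability of the class C^1 on an open set *)

Section C1.
Context {n : nat}.
Implicit Types (U W : set 'rV[R]_n) (f g : 'rV[R]_n -> R).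

Lemma Ck1_differentiable U f x : open U -> Ck_on 1 U f -> U x ->
  differentiable f x /\ 'd f x = dir_deriv f x :> (_ -> _).
Proof.
move=> oU [_ Cf] Ux; apply: differentiable_partials.
  apply: (near_open oU Ux) => y Uy i.
  by have [+ _] := Cf i; exact.
by move=> i; have [_ [+ _]] := Cf i; exact.
Qed.

Lemma Ck1_derivable U f x i : Ck_on 1 U f -> U x ->
  is_derive x (delta_mx ord0 i) f ('D_(delta_mx ord0 i) f x).
Proof. by move=> [_ /(_ i)[df _]] Ux; exact/derivableP/df. Qed.
Arguments Ck1_derivable [U f x] i _ _.

Lemma Ck1_cvg_partial U f x i : Ck_on 1 U f -> U x ->
  {for x, continuous (fun y => 'D_(delta_mx ord0 i) f y)}.
Proof. by move=> [_ /(_ i)[_ [+ _]]]; exact. Qed.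
Arguments Ck1_cvg_partial [U f x] i _ _.

(** Reduces C^1 to a continuous formula for each partial derivative; continuity of [f] itself then
    comes from [differentiable_partials]. *)
Lemma Ck1_intro U f (D : 'I_n -> 'rV[R]_n -> R) : open U ->
  (forall i x, U x -> is_derive x (delta_mx ord0 i) f (D i x)) ->
  (forall i x, U x -> {for x, continuous (D i)}) -> Ck_on 1 U f.
Proof.
move=> oU df cD.
have dD i x : U x -> {for x, continuous (fun y => 'D_(delta_mx ord0 i) f y)}.
  move=> Ux; apply: (continuous_at_eq_open oU Ux _ (cD i x Ux)) => y Uy.
  by have [_ E] := df i y Uy; rewrite -E.
split => [x Ux|i]; last first.
  split => [x Ux|]; first by have [] := df i x Ux.
  by split => // x Ux; exact: dD.
have dn : \forall y \near x, forall i, derivable f y (delta_mx ord0 i).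
  apply: (@near_open _ U (fun y => forall i, derivable f y (delta_mx ord0 i)) _ oU Ux).
  by move=> y Uy i; have [] := df i y Uy.
apply: differentiable_continuous.
exact: (differentiable_partials dn (fun i => dD i x Ux)).1.
Qed.

Lemma Ck1_eq U f g : open U -> (forall x, U x -> f x = g x) ->
  Ck_on 1 U f -> Ck_on 1 U g.
Proof.
move=> oU fg Cf; apply: (@Ck1_intro _ _ (fun i x => 'D_(delta_mx ord0 i) f x)) => //.
  move=> i x Ux; have [df E] := Ck1_derivable i Cf Ux.
  have fgx : \near x, f x = g x.
    by apply: (near_open oU Ux) => y Uy; exact: fg.
  split; first exact: near_eq_derivable fgx df.
  by rewrite -(near_eq_derive _ fgx).
by move=> i x; exact: Ck1_cvg_partial.
Qed.

Lemma Ck1_subset U W f : U `<=` W -> Ck_on 1 W f -> Ck_on 1 U f.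
Proof.
move=> UW [cf df]; split=> [x /UW|i]; first exact: cf.
have [d1 [d2 _]] := df i; split; first by move=> x /UW; exact: d1.
by split => // x /UW; exact: d2.
Qed.

Lemma Ck1_local U f : open U ->
  (forall x, U x -> exists W, [/\ open W, W x & Ck_on 1 W f]) -> Ck_on 1 U f.
Proof.
move=> oU fl; apply: (@Ck1_intro _ _ (fun i x => 'D_(delta_mx ord0 i) f x)) => //.
  by move=> i x /fl[W [_ Wx Cf]]; exact: Ck1_derivable _ Cf Wx.
by move=> i x /fl[W [_ Wx Cf]]; exact: Ck1_cvg_partial i Cf Wx.
Qed.

Lemma Ck1_cst U a : open U -> Ck_on 1 U (fun=> a).
Proof.
move=> oU; apply: (@Ck1_intro _ _ (fun _ _ => 0)) => // i x _.
exact: cst_continuous.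
Qed.

Lemma Ck1_add U f g : open U -> Ck_on 1 U f -> Ck_on 1 U g ->
  Ck_on 1 U (fun x => f x + g x).
Proof.
move=> oU Cf Cg; apply: (@Ck1_intro _ _
  (fun i x => 'D_(delta_mx ord0 i) f x + 'D_(delta_mx ord0 i) g x)) => // i x Ux.
  by apply: is_deriveD; [exact: Ck1_derivable _ Cf Ux|exact: Ck1_derivable _ Cg Ux].
exact: continuousD (Ck1_cvg_partial i Cf Ux) (Ck1_cvg_partial i Cg Ux).
Qed.

Lemma Ck1_mul U f g : open U -> Ck_on 1 U f -> Ck_on 1 U g ->
  Ck_on 1 U (fun x => f x * g x).
Proof.
move=> oU Cf Cg; apply: (@Ck1_intro _ _
  (fun i x => f x *: 'D_(delta_mx ord0 i) g x + g x *: 'D_(delta_mx ord0 i) f x))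
  => // i x Ux.
  by apply: is_deriveM; [exact: Ck1_derivable _ Cf Ux|exact: Ck1_derivable _ Cg Ux].
exact: continuousD (continuousM (Cf.1 x Ux) (Ck1_cvg_partial i Cg Ux))
                   (continuousM (Cg.1 x Ux) (Ck1_cvg_partial i Cf Ux)).
Qed.

Lemma Ck1_sum (I : finType) U (f : I -> 'rV[R]_n -> R) : open U ->
  (forall i, Ck_on 1 U (f i)) -> Ck_on 1 U (fun x => \sum_i f i x).
Proof.
move=> oU Cf; elim: (index_enum I) => [|a s IH].
  by under eq_fun do rewrite big_nil; exact: Ck1_cst.
by under eq_fun do rewrite big_cons; exact: Ck1_add.
Qed.

Lemma Ck1_prod (I : finType) U (f : I -> 'rV[R]_n -> R) : open U ->
  (forall i, Ck_on 1 U (f i)) -> Ck_on 1 U (fun x => \prod_i f i x).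
Proof.
move=> oU Cf; elim: (index_enum I) => [|a s IH].
  by under eq_fun do rewrite big_nil; exact: Ck1_cst.
by under eq_fun do rewrite big_cons; exact: Ck1_mul.
Qed.

Lemma Ck1_comp1 U f (phi dphi : R -> R) : open U ->
  (forall t : R, is_derive t 1 phi (dphi t)) -> continuous dphi ->
  Ck_on 1 U f -> Ck_on 1 U (phi \o f).
Proof.
move=> oU dp cp Cf; apply: (@Ck1_intro _ _
  (fun i x => dphi (f x) * 'D_(delta_mx ord0 i) f x)) => // i x Ux.
  by apply: is_derive_comp1 => //; exact: Ck1_derivable _ Cf Ux.
exact: continuousM (continuous_comp (Cf.1 x Ux) (cp _)) (Ck1_cvg_partial i Cf Ux).
Qed.

End C1.

End Calculus.

(** * Theorems of the alternative *)

Section Alternatives.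
Context {R : realFieldType}.
Implicit Types (V : lmodType R) (I J K : finType).

Lemma scalar_fun0 V (f : V -> R) : scalar f -> f 0 = 0.
Proof. by move=> lf; have := lf (-1) 0 0; rewrite scaler0 addr0 mulN1r addNr. Qed.

Lemma scalar_funZ V (f : V -> R) a x : scalar f -> f (a *: x) = a * f x.
Proof. by move=> lf; have := lf a x 0; rewrite addr0 scalar_fun0// addr0. Qed.

Lemma scalar_funD V (f : V -> R) x y : scalar f -> f (x + y) = f x + f y.
Proof. by move=> lf; have := lf 1 x y; rewrite scale1r mul1r. Qed.

Lemma scalar_funB V (f : V -> R) x y : scalar f -> f (x - y) = f x - f y.
Proof. by move=> lf; rewrite addrC -scaleN1r lf mulN1r addrC. Qed.

(* Bartl's proof: if the last inequality is needed, some [y] violates [ga] while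
   satisfying the others; eliminate along [y]. *)
Lemma farkas_seq V I (s : seq I) (al : I -> V -> R) (ga : V -> R) :
  uniq s -> (forall i, scalar (al i)) -> scalar ga ->
  (forall x, (forall i, i \in s -> al i x <= 0) -> ga x <= 0) ->
  exists2 la : I -> R, (forall i, 0 <= la i) &
    forall x, ga x = \sum_(i <- s) la i * al i x.
Proof.
elim: s al ga => [|a s IH] al ga /=.
  move=> _ _ lga gaP; exists (fun=> 0) => // x; rewrite big_nil; apply/eqP.
  rewrite eq_le gaP//= -oppr_le0 -mulN1r -scalar_funZ//; exact: gaP.
case/andP=> as_ us lal lga gaP.
have [H|/existsNP[y /not_implyP[ys /negP]]] :=
  pselect (forall x, (forall i, i \in s -> al i x <= 0) -> ga x <= 0).
  have [la la0 laE] := IH _ _ us lal lga H.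
  exists (fun i => if i == a then 0 else la i).
    by move=> i; case: ifP.
  move=> x; rewrite big_cons eqxx mul0r add0r laE; apply: eq_big_seq => i is_.
  by case: eqP => // ia; rewrite -ia is_ in as_.
rewrite -ltNge => gay.
have aly : 0 < al a y.
  rewrite ltNge; apply/negP => aly; have := gaP y; rewrite leNgt gay => /(_ _)/notF.
  apply=> i; rewrite inE => /orP[/eqP->//|]; exact: ys.
pose b i := al i y / al a y.
pose c := ga y / al a y.
have lin (f : V -> R) k : scalar f -> scalar (fun x => f x - k * al a x).
  by move=> lf d u v; rewrite lf lal; ring.
(* The reduced functionals are the old ones evaluated at [x - (al a x / al a y) *: y], a point where
   [al a] vanishes; so the constraint [a] holds there for free. *)
have [//|x xs|la la0 laE] :=
    IH (fun i x => al i x - b i * al a x) (fun x => ga x - c * al a x) us _ (lin _ _ lga).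
  by move=> i; exact: lin.
- have E (f : V -> R) : scalar f ->
      f (x - (al a x / al a y) *: y) = f x - f y / al a y * al a x.
    by move=> lf; rewrite scalar_funB// scalar_funZ// mulrAC [_ * f y]mulrC mulrAC.
  rewrite -E//; apply: gaP => i; rewrite inE => /orP[/eqP->|is_].
    by rewrite E// divff ?mul1r ?subrr// gt_eqF.
  by rewrite E//; exact: xs.
(* The weight of [a] collects what the elimination removed. It is nonnegative because [al i y <= 0]
   on [s], while [ga y] and [al a y] are positive. *)
exists (fun i => if i == a then c - \sum_(j <- s) la j * b j else la i).
  move=> i; case: eqP => // _; rewrite subr_ge0 (@le_trans _ _ 0)//; last first.
    by rewrite divr_ge0// ltW.
  rewrite big_seq; apply: sumr_le0 => j js.
  by rewrite mulr_ge0_le0// mulr_le0_ge0 ?ys// invr_ge0 ltW.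
move=> x; rewrite big_cons eqxx.
have -> : \sum_(j <- s) (if j == a then c - \sum_(j0 <- s) la j0 * b j0 else la j) * al j x
    = \sum_(j <- s) la j * al j x.
  apply: eq_big_seq => i is_.
  by case: eqP => // ia; rewrite -ia is_ in as_.
have := laE x; under eq_bigr do rewrite mulrBr mulrA.
rewrite sumrB -mulr_suml => /eqP; rewrite subr_eq => /eqP ->; ring.
Qed.

(** Each equality becomes two opposite inequalities, and [ka] is the difference of their weights. *)
Lemma farkas V I J (al : I -> V -> R) (be : J -> V -> R) (ga : V -> R) :
  (forall i, scalar (al i)) -> (forall j, scalar (be j)) -> scalar ga ->
  (forall x, (forall i, al i x <= 0) -> (forall j, be j x = 0) -> ga x <= 0) ->
  exists (la : I -> R) (ka : J -> R), (forall i, 0 <= la i) /\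
    forall x, ga x = \sum_i la i * al i x + \sum_j ka j * be j x.
Proof.
move=> lal lbe lga gaP.
pose c (k : I + (J + J)) (x : V) := match k with
  | inl i => al i x | inr (inl j) => be j x | inr (inr j) => - be j x end.
have lc k : scalar (c k).
  by case: k => [i|[j|j]] d u v //=; [exact: lal|exact: lbe|rewrite lbe; ring].
have [|la la0 laE] := farkas_seq (index_enum_uniq _) lc lga.
  move=> x H; apply: gaP => [i|j]; first exact: (H (inl i)).
  apply/eqP; rewrite eq_le (H (inr (inl j)))// -oppr_le0.
  exact: (H (inr (inr j))).
exists (fun i => la (inl i)), (fun j => la (inr (inl j)) - la (inr (inr j))).
split=> [i|x]; first exact: la0.
rewrite laE big_sumType/= big_sumType/= -big_split/=; congr (_ + _).
by apply: eq_bigr => j _; ring.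
Qed.

(** A slack variable [t] gives a system in Farkas form: [al i x + t <= 0] and [be j x = 0] imply
    [t <= 0]. The resulting identity at [(0, 1)] normalizes [la], and at [(x, 0)] it is the wanted
    relation. *)
Lemma motzkin V I J (al : I -> V -> R) (be : J -> V -> R) :
  (forall i, scalar (al i)) -> (forall j, scalar (be j)) ->
  ~ (exists x, (forall i, al i x < 0) /\ forall j, be j x = 0) ->
  exists (la : I -> R) (ka : J -> R), [/\ forall i, 0 <= la i, \sum_i la i = 1 &
    forall x, \sum_i la i * al i x + \sum_j ka j * be j x = 0].
Proof.
move=> lal lbe nex.
have [||//||la [ka [la0 E]]] := @farkas (V * R^o)%type I J
  (fun i x => al i x.1 + x.2) (fun j x => be j x.1) snd.
- by move=> i d u v /=; rewrite lal mulrDr addrACA.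
- by move=> j d u v /=; rewrite lbe.
- move=> [x t] /= alx bex; rewrite leNgt; apply/negP => t0; apply: nex; exists x.
  split=> // i; have := alx i; lra.
exists la, ka; split => // [|x].
  have := E (0, 1); rewrite /= [X in _ = _ + X]big1 ?addr0.
    by move=> E1; rewrite [RHS]E1; apply: eq_bigr => i _; rewrite scalar_fun0// add0r mulr1.
  by move=> j _; rewrite scalar_fun0// mulr0.
have /= E0 := E (x, 0); rewrite [RHS]E0; congr (_ + _).
by apply: eq_bigr => i _; rewrite addr0.
Qed.

(** For each [l], a vector annihilated by the other functionals and with [psi l x > 0] is rescaled.
    If there is none, [farkas] without inequalities expresses [psi l] through the others, against
    independence. *)
Lemma dual_family V K (psi : K -> V -> R) :
  (forall k, scalar (psi k)) ->
  (forall a : K -> R, (forall x, \sum_k a k * psi k x = 0) -> forall k, a k = 0) ->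
  exists u : K -> V, forall l k, psi k (u l) = (k == l)%:R.
Proof.
move=> lpsi indep.
suff /choice[u uP] : forall l, exists x, forall k, psi k x = (k == l)%:R by exists u.
move=> l.
have [[x [x0 xl]]|nex] := pselect (exists x, (forall k, k != l -> psi k x = 0) /\ 0 < psi l x).
  exists ((psi l x)^-1 *: x) => k; rewrite scalar_funZ//.
  have [->|kl] := eqVneq k l; first by rewrite mulVf// gt_eqF.
  by rewrite (x0 _ kl) mulr0.
(* Zeroing the entry [l] keeps [K] as the index type of the remaining functionals. *)
pose be (k : K) (x : V) := if k == l then 0 else psi k x.
have lbe k : scalar (be k).
  by rewrite /be => d u v; case: eqP => // _; [ring|exact: lpsi].
have [//|x _ xbe|la [ka [_ E]]] := @farkas V void K (fun _ _ => 0) be (psi l) _ lbe (lpsi l).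
  rewrite leNgt; apply/negP => xl; apply: nex; exists x; split => // k kl.
  by have := xbe k; rewrite /be (negbTE kl).
suff /(_ l)/eqP : forall k, (if k == l then 1 else - ka k) = 0 by rewrite eqxx oner_eq0.
apply: indep => x; rewrite (bigD1 l)//= eqxx mul1r E big1 ?add0r; last by case.
rewrite (bigD1 l)//= /be eqxx mulr0 add0r -big_split/= big1// => k kl.
by rewrite (negbTE kl) mulNr addrN.
Qed.

End Alternatives.

(** * Charts and tangent vectors *)

Section Charts.
Context {R : realType} {n : nat}.

Lemma chart_image_open (T : topologicalType) (c : chart R n T) (V : set T) :
  open V -> open (c @` (chart_dom c `&` V)).
Proof.
move=> oV; rewrite openE => _ [x [cx Vx] <-].
have icx : (c @` chart_dom c) (c x) by exists x.
have nV : nbhs (c x) (chart_inv c @^-1` V).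
  apply: (chart_inv_cont icx); rewrite chart_mapK//; exact: open_nbhs_nbhs.
have nI : nbhs (c x) (c @` chart_dom c).
  by apply: open_nbhs_nbhs; split => //; exact: chart_img_open.
apply: filterS (filterI nV nI) => y [Vy [z cz zy]].
by exists z => //; split => //; move: Vy; rewrite -zy /= chart_mapK.
Qed.

Lemma tangent_eq (M : smooth_manifold R n) (p : M) (xi eta : tangent p) :
  xi = eta :> (C1near p -> R) -> xi = eta.
Proof.
case: xi => f hf; case: eta => g hg /= fg; subst g.
by congr MkTangent; exact: Prop_irrelevance.
Qed.

Lemma is_derive_affine k (x v : 'rV[R]_k) (t : R) j :
  is_derive t 1 (fun u : R => (x + u *: v) ord0 j) (v ord0 j).
Proof.
have -> : (fun u : R => (x + u *: v) ord0 j) = cst (x ord0 j) + (v ord0 j *: id).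
  by apply/funext => u; rewrite !mxE !fctE mulrC.
have := is_deriveD (is_derive_cst (x ord0 j) t (1 : R))
  (is_deriveZ (v ord0 j) (is_derive_id t (1 : R))).
by rewrite add0r [_%:A]mulr1.
Qed.

Lemma continuous_line k (x v : 'rV[R]_k) : continuous (fun t : R => x + t *: v).
Proof. by move=> t; apply: cvgD; [exact: cvg_cst|apply: cvgZl]. Qed.

Context {M : smooth_manifold R n} (p : M) (c : chart R n M).
Hypotheses (ac : atlas c) (cp : chart_dom c p).

Lemma chart_img_nbhs : nbhs (c p) (c @` chart_dom c).
Proof.
by apply: open_nbhs_nbhs; split; [exact: chart_img_open|exists p].
Qed.

Lemma C1near_chart (s : C1near p) : exists W, [/\ open W, W (c p),
  W `<=` c @` chart_dom c & Ck_on 1 W (s \o chart_inv c)].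
Proof.
have [V [oV Vp Cs]] := C1nearP s.
exists (c @` (chart_dom c `&` V)); split; [exact: chart_image_open|by exists p| |exact: Cs].
by move=> _ [x [cx _] <-]; exists x.
Qed.

Lemma C1near_diff (s : C1near p) : differentiable (s \o chart_inv c) (c p) /\
  'd (s \o chart_inv c) (c p) = dir_deriv (s \o chart_inv c) (c p) :> (_ -> _).
Proof.
by have [W [oW Wp _ Cs]] := C1near_chart s; exact: Ck1_differentiable Cs Wp.
Qed.

(** The curve is the straight line with direction [v] in the chart. Read in another chart [d] it is
    that line followed by a transition map, which is C^1 by compatibility of the atlas. *)
Lemma tangent_of_vector (v : 'rV[R]_n) :
  exists xi : tangent p, forall s, xi s = dir_deriv (s \o chart_inv c) (c p) v.
Proof.
pose ga (t : R) := chart_inv c (c p + t *: v).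
have [r /= r0 rP] := (nbhs_ballP _ _).1 chart_img_nbhs.
(* For [|t| < e] the line stays in the ball of radius [r] inside the chart image; adding 1 keeps the
   denominator positive when [v = 0]. *)
pose e := r / (`|v| + 1).
have v1 : 0 < `|v| + 1 by rewrite ltr_wpDl.
have img t : -e < t < e -> (c @` chart_dom c) (c p + t *: v).
  rewrite -ltr_norml => te; apply: rP.
  rewrite -ball_normE/= opprD addNKr normrN normrZ.
  rewrite (@le_lt_trans _ _ (`|t| * (`|v| + 1)))//; first by rewrite ler_wpM2l// lerDl.
  by rewrite -ltr_pdivlMr.
have curve : C1_curve p e ga.
  split.
  - by rewrite divr_gt0.
  - by rewrite /ga scale0r addr0 chart_mapK.
  - move=> t te; apply: (@continuous_comp _ _ _ (fun t : R => c p + t *: v)).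
      exact: continuous_line.
    exact: chart_inv_cont (img t te).
  - move=> d ad t te dt i.
    pose F y := d (chart_inv c y) ord0 i.
    pose W := c @` (chart_dom c `&` chart_dom d).
    have oW : open W by apply: chart_image_open; exact: chart_dom_open.
    have CF : Ck_on 1 W F by exact: atlas_compatible ac ad 1%N i.
    have Wt : W (c p + t *: v).
      have [x cx xE] := img t te; exists x => //; split => //.
      by move: dt; rewrite /ga -xE chart_mapK.
    have dF u : W (c p + u *: v) ->
        is_derive u 1 (fun u => d (ga u) ord0 i) (dir_deriv F (c p + u *: v) v).
      move=> Wu; have [dF1 dF2] := Ck1_differentiable oW CF Wu.
      apply: (is_derive_chain (tau := fun u : R => c p + u *: v) dF1 dF2) => j.
      exact: is_derive_affine.
    split; first by have [] := dF t Wt.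
    pose O := (fun u : R => c p + u *: v) @^-1` W.
    have oO : open O by apply: open_comp => // u _; exact: continuous_line.
    apply: (@continuous_at_eq_open _ _ O (fun u : R => dir_deriv F (c p + u *: v) v) _ t oO Wt).
      by move=> u Wu; rewrite derive1E; have [_ E] := dF u Wu; rewrite -E.
    apply: continuous_at_sum => j; apply: continuousM; first exact: cst_continuous.
    apply: (@continuous_comp _ _ _ (fun u : R => c p + u *: v)
      (fun y => 'D_(delta_mx ord0 j) F y)); first exact: continuous_line.
    exact: Ck1_cvg_partial CF Wt.
have xiP : exists (e : R) (gamma : R -> M), C1_curve p e gamma /\
    velocity ga (p := p) = velocity gamma (p := p) by exists e, ga.
exists (MkTangent xiP) => s /=; rewrite /velocity derive1E.
have [ds1 ds2] := C1near_diff s.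
have c0 : c p + 0 *: v = c p by rewrite scale0r addr0.
have [] := @is_derive_chain _ _ _ (s \o chart_inv c) (fun u : R => c p + u *: v) 0 1 v.
- by rewrite c0.
- by rewrite c0.
- by move=> j; exact: is_derive_affine.
- by rewrite c0.
Qed.

(** [v] is the velocity at 0 of the coordinate curve [c \o ga]; the chain rule gives the formula. *)
Lemma vector_of_tangent (xi : tangent p) :
  exists v, forall s, xi s = dir_deriv (s \o chart_inv c) (c p) v.
Proof.
case: xi => f [e [ga [[e0 ga0 cga dga] /= ->]]].
have e00 : -e < 0 < e by rewrite oppr_lt0 e0.
have cga0 : chart_dom c (ga 0) by rewrite ga0.
pose v : 'rV[R]_n := \row_j 'D_1 (fun u => c (ga u) ord0 j) 0.
exists v => s; rewrite /velocity derive1E.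
have gac : \forall u \near (0 : R), chart_dom c (ga u).
  apply: (cga 0 e00); rewrite ga0; apply: open_nbhs_nbhs.
  by split => //; exact: chart_dom_open.
have -> : 'D_1 (s \o ga) 0 = 'D_1 ((s \o chart_inv c) \o (c \o ga)) 0.
  by apply: near_eq_derive; apply: filterS gac => u cu; rewrite /= chart_mapK.
have [ds1 ds2] := C1near_diff s.
have [] := @is_derive_chain _ _ _ (s \o chart_inv c) (c \o ga) 0 1 v.
- by rewrite /= ga0.
- by rewrite /= ga0.
- move=> j; rewrite mxE; apply: derivableP; exact: (dga c ac 0 e00 cga0 j).1.
- by rewrite /= ga0.
Qed.

Lemma tangent_param : exists T : 'rV[R]_n -> tangent p,
  (forall v s, T v s = dir_deriv (s \o chart_inv c) (c p) v) /\
  (forall xi, exists v, xi = T v).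
Proof.
have [T TP] := choice tangent_of_vector; exists T; split => // xi.
have [v vP] := vector_of_tangent xi; exists v; apply: tangent_eq.
by apply/funext => s; rewrite vP TP.
Qed.

(** Lets tangent cone membership be checked in coordinates: one limit [v] of the coordinate
    quotients yields the limits for all [s], by the first-order expansion of [s] in the chart. *)
Lemma difference_quotient_cvg (pk : nat -> M) (tk : nat -> R) v (s : C1near p) :
  (forall k, chart_dom c (pk k)) -> (forall k, 0 < tk k) ->
  tk k @[k --> \oo] --> (0 : R) ->
  (tk k)^-1 *: (c (pk k) - c p) @[k --> \oo] --> v ->
  pk k @[k --> \oo] --> p /\
  (s (pk k) - s p) / tk k @[k --> \oo] --> dir_deriv (s \o chart_inv c) (c p) v.
Proof.
move=> cpk tk0 tk_cvg vk_cvg.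
pose vk k := (tk k)^-1 *: (c (pk k) - c p).
have ckE k : c (pk k) = tk k *: vk k + c p.
  by rewrite scalerA divff ?scale1r ?subrK// gt_eqF.
have hk : tk k *: vk k @[k --> \oo] --> (0 : 'rV[R]_n).
  by rewrite -(scale0r v); exact: cvgZ.
have ck : c (pk k) @[k --> \oo] --> c p.
  have : tk k *: vk k + c p @[k --> \oo] --> 0 + c p.
    by apply: cvgD => //; exact: cvg_cst.
  by rewrite add0r; under eq_fun do rewrite -ckE.
split.
  have pE : pk = chart_inv c \o (c \o pk).
    by apply/funext => k /=; rewrite chart_mapK.
  have icont : {for c p, continuous (chart_inv c)} by apply: chart_inv_cont; exists p.
  have : (chart_inv c \o (c \o pk)) k @[k --> \oo] --> chart_inv c (c p).
    exact: (continuous_cvg _ icont ck).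
  by rewrite -pE chart_mapK.
have [ds1 ds2] := C1near_diff s.
set f := s \o chart_inv c.
have Lvk : dir_deriv f (c p) (vk k) @[k --> \oo] --> dir_deriv f (c p) v.
  exact: (continuous_cvg _ (@dir_deriv_continuous _ _ f (c p) v) vk_cvg).
have rem : (s (pk k) - s p) / tk k - dir_deriv f (c p) (vk k) @[k --> \oo] --> (0 : R).
  apply/cvgrPdist_le => e e0.
  have v1 : 0 < `|v| + 1 by rewrite ltr_wpDl.
  have /diff_locally/eqaddoP/(_ (e / (`|v| + 1))) := ds1.
  rewrite divr_gt0// => /(_ isT); rewrite ds2 => near0.
  (* [vk] converges, hence is eventually bounded by [|v| + 1]; this turns a remainder small against
     [tk k *: vk k] into one small against [tk k]. *)
  have nv : \forall k \near \oo, `|vk k| <= `|v| + 1.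
    have /cvgrPdist_le/(_ 1 ltr01) := vk_cvg; apply: filterS => k vk1.
    rewrite -[vk k](subrK v) addrC (le_trans (ler_normD _ _))// lerD2l.
    by rewrite distrC.
  apply: filterS (filterI nv (hk _ near0)) => k [nvk /=].
  rewrite !fctE/= -ckE /f /= !chart_mapK// sub0r normrN => H.
  have -> : (s (pk k) - s p) / tk k - dir_deriv (s \o chart_inv c) (c p) (vk k)
     = (s (pk k) - (s p + dir_deriv (s \o chart_inv c) (c p) (tk k *: vk k))) / tk k.
    have key (a b D t : R) : t != 0 -> (a - b) / t - D = (a - (b + t * D)) / t.
      by move=> t0; field.
    by rewrite (dir_derivZ _ _ (tk k)) key// lt0r_neq0.
  rewrite normrM normfV (gtr0_norm (tk0 k)) ler_pdivrMr//; apply: (le_trans H).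
  rewrite normrZ (gtr0_norm (tk0 k)) mulrAC mulrA -mulrA -[leRHS]mulr1.
  by rewrite ler_pM2l ?mulr_gt0// ler_pdivrMr// mul1r.
have -> : (fun k => (s (pk k) - s p) / tk k) =
    (fun k => (s (pk k) - s p) / tk k - dir_deriv f (c p) (vk k)) +
    (fun k => dir_deriv f (c p) (vk k)).
  by apply/funext => k; rewrite !fctE subrK.
by rewrite -[dir_deriv f (c p) v]add0r; exact: cvgD.
Qed.

End Charts.

(** * A C^1 majorant in one variable *)

Section OneVariable.
Context {R : realType}.

(** Integrating from -1 makes 0 an interior point of the interval, so the fundamental theorem of
    calculus holds there on both sides; for [x <= -1] the primitive vanishes near [x]. *)
Lemma truncated_primitive (f : R -> R) : continuous f ->
  (forall t, t <= 0 -> f t = 0) ->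
  exists2 H : R -> R, (forall t : R, is_derive t 1 H (f t)) &
    forall t, t <= 0 -> H t = 0.
Proof.
move=> cf f0; pose H (x : R) := (\int[lebesgue_measure]_(t in `[(-1 : R), x]) f t)%R.
have H0 t : t <= 0 -> H t = 0.
  move=> t0; rewrite /H (@eq_Rintegral _ _ _ _ _ (fun=> 0)).
    by rewrite /Rintegral integral0.
  by move=> u; rewrite inE/= in_itv/= => /andP[_ ut]; rewrite f0// (le_trans ut).
exists H => // x; have [x1|x1] := ltP (-1) x.
  have xx1 : x < x + 1 by rewrite ltrDl.
  have intf : (@lebesgue_measure R).-integrable `[-1, x + 1] (EFin \o f).
    apply: continuous_compact_integrable; first exact: segment_compact.
    exact: continuous_subspaceT.
  have [dH HE] := continuous_FTC1_closed xx1 intf x1 (cf x).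
  by split; [exact: dH|rewrite -derive1E; exact: HE].
rewrite f0; last by rewrite (le_trans x1)// oppr_le0.
have nH : \near x, (cst 0 : R -> R) x = H x.
  have x0 : x < 0 by rewrite (le_lt_trans x1)// oppr_lt0.
  by apply: (near_open (@open_lt R 0) x0) => y /= /ltW/H0 ->.
have dc : is_derive x (1 : R) (cst 0 : R -> R) 0 by exact: is_derive_cst.
split; first by apply: near_eq_derivable nH _; case: dc.
by rewrite -(near_eq_derive _ nH); case: dc.
Qed.

Lemma is_derive_half_sqr (t : R) : is_derive t 1 (fun u : R => u ^+ 2 / 2) t.
Proof.
have -> : (fun u : R => u ^+ 2 / 2) = 2^-1 *: (id : R -> R) ^+ 2.
  by apply/funext => u; rewrite mulrC.
by apply: is_derive_eq; rewrite [_%:A]mulr1 expr1 [LHS]mulrA mulVf ?mul1r// pnatr_eq0.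
Qed.

Lemma pos_part_continuous : continuous (fun t : R => Num.max 0 t).
Proof.
by move=> t; apply: (@continuous_max _ _ (fun=> 0) id); [exact: cst_continuous|].
Qed.

(** [H] is half the squared positive part, obtained as a primitive so that its derivative at 0 needs
    no separate treatment. It serves as the profile of the bump function and as the penalty for
    inequality constraints. *)
Lemma pos_part_primitive : exists H : R -> R,
  [/\ forall t : R, is_derive t 1 H (Num.max 0 t),
      forall t, t <= 0 -> H t = 0 & forall t, 0 < t -> 0 < H t].
Proof.
have [|H dH H0] := truncated_primitive pos_part_continuous.
  by move=> t t0; apply/max_idPl.
exists H; split => // t t0.
have dH' (u : R) : u \in `]0, t[ -> is_derive u 1 H (Num.max 0 u) by [].
have cH : {within `[0, t], continuous H}.
  by apply: derivable_within_continuous => u _; case: (dH u).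
have [u] := MVT t0 dH' cH; rewrite in_itv/= (H0 0)// !subr0 => /andP[u0 ut] ->.
by rewrite mulr_gt0// lt_max u0 orbT.
Qed.

(* The infimum of the affine functions [r |-> a + b r] is concave, hence
   continuous, and its primitive gives the majorant. *)
Section Majorant.
Variable S : set (R * R).
Hypothesis S_ge0 : forall ab, S ab -> 0 <= ab.1 /\ 0 <= ab.2.
Hypothesis S_small : forall e, 0 < e -> exists2 ab, S ab & ab.1 <= e.

(** Together with [S_small], the positive part makes [om] vanish for [r <= 0], as
    [truncated_primitive] requires. *)
Let om (r : R) : R := inf [set ab.1 + ab.2 * Num.max 0 r | ab in S].

Let om_lb ab r : S ab -> om r <= ab.1 + ab.2 * Num.max 0 r.
Proof.
move=> Sab; apply: ge_inf; last by exists ab.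
exists 0 => _ [cd /S_ge0[c0 d0] <-]; rewrite addr_ge0// mulr_ge0//.
by rewrite le_max lexx.
Qed.

Let om_glb r y : (forall ab, S ab -> y <= ab.1 + ab.2 * Num.max 0 r) -> y <= om r.
Proof.
move=> yS; apply: lb_le_inf.
  by have [ab Sab _] := S_small ltr01; exists (ab.1 + ab.2 * Num.max 0 r), ab.
by move=> _ [ab Sab <-]; exact: yS.
Qed.

Let om_ge0 r : 0 <= om r.
Proof.
apply: om_glb => ab /S_ge0[a0 b0]; rewrite addr_ge0// mulr_ge0//.
by rewrite le_max lexx.
Qed.

Let om_le0 r : r <= 0 -> om r = 0.
Proof.
move=> r0; apply/eqP; rewrite eq_le om_ge0 andbT; apply/ler_addgt0Pr => e e0.
have [ab Sab abe] := S_small e0; rewrite add0r (le_trans (om_lb r Sab))//.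
by have /max_idPl -> := r0; rewrite mulr0 addr0.
Qed.

Let om_mono r s : r <= s -> om r <= om s.
Proof.
move=> rs; apply: om_glb => ab Sab; apply: (le_trans (om_lb r Sab)).
rewrite lerD2l ler_wpM2l ?(S_ge0 Sab).2//.
by rewrite ge_max le_max lexx /= le_max rs orbT.
Qed.

(** The part of concavity that is used: no [(a + b * r) / r] increases with [r > 0], hence neither
    does [om r / r]. *)
Let om_slope r s : 0 < r -> r <= s -> r * om s <= s * om r.
Proof.
move=> r0 rs; have s0 := lt_le_trans r0 rs.
rewrite -ler_pdivrMl//; apply: om_glb => ab Sab; rewrite ler_pdivrMl//.
apply: (@le_trans _ _ (r * (ab.1 + ab.2 * Num.max 0 s))).
  by rewrite ler_pM2l//; exact: om_lb.
have /ltW/max_idPr -> := r0; have /ltW/max_idPr -> := s0.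
have [a0 b0] := S_ge0 Sab.
rewrite !mulrDr [r * (ab.2 * s)]mulrCA [s * (ab.2 * r)]mulrCA [s * r]mulrC lerD2r.
by rewrite ler_wpM2r.
Qed.

Let om_continuous : continuous om.
Proof.
move=> t; apply/cvgrPdist_le => e e0; have [t0|t0] := leP t 0.
  have e2 : 0 < e / 2 by rewrite divr_gt0.
  (* At [t <= 0] one affine function with constant term at most [e / 2] already bounds [om] near
     [t]. *)
  have [ab Sab abe] := S_small e2; have [a0 b0] := S_ge0 Sab.
  have b1 : 0 < ab.2 + 1 by rewrite ltr_wpDl.
  apply/nbhs_ballP; exists (e / 2 / (ab.2 + 1)); first by rewrite /= divr_gt0.
  move=> u; rewrite /ball/= om_le0// sub0r normrN (ger0_norm (om_ge0 u)) => tu.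
  apply: (le_trans (om_lb u Sab)); rewrite [leRHS]splitr lerD//.
  apply: (@le_trans _ _ ((ab.2 + 1) * `|t - u|)); last first.
    by rewrite mulrC -ler_pdivlMr// ltW.
  apply: ler_pM => //; first by rewrite le_max lexx.
    by rewrite lerDl.
  rewrite ge_max normr_ge0/= distrC (le_trans _ (ler_norm _))//.
  by rewrite lerDl oppr_ge0.
have k0 : 0 < 2 * om t / t + 1 by rewrite ltr_wpDl// divr_ge0 ?mulr_ge0// ltW.
have d0 : 0 < Num.min (t / 2) (e / (2 * om t / t + 1)).
  by rewrite lt_min !divr_gt0.
apply/nbhs_ballP; exists (Num.min (t / 2) (e / (2 * om t / t + 1))) => //.
move=> u; rewrite /ball/= lt_min => /andP[tu1 tu2].
have u2 : t / 2 < u by move: tu1; rewrite ltr_norml => /andP[]; lra.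
have u0 : 0 < u by apply: lt_trans u2; rewrite divr_gt0.
(* For [u > t / 2], monotonicity and [om_slope] give a Lipschitz estimate at [t] with constant
   [2 * om t / t]. *)
suff H : `|om t - om u| <= `|t - u| * (2 * om t / t).
  apply: (le_trans H); apply: (@le_trans _ _ (`|t - u| * (2 * om t / t + 1))).
    by rewrite ler_wpM2l// lerDl.
  by rewrite -ler_pdivlMr// ltW.
rewrite !mulrA ler_pdivlMr//.
have w0 := om_ge0 t.
have [tu|/ltW ut] := leP t u.
  have h1 := om_mono tu; have h2 := om_slope t0 tu.
  rewrite distrC [`|t - u|]distrC !ger0_norm ?subr_ge0//.
  have : 0 <= (u - t) * om t by rewrite mulr_ge0// subr_ge0.
  nra.
have h1 := om_mono ut; have h2 := om_slope u0 ut.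
rewrite !ger0_norm ?subr_ge0//.
have h3 : 0 <= (t - u) * om t by rewrite mulr_ge0// subr_ge0.
have h4 : (om t - om u) * u <= (t - u) * om u by nra.
have h5 : (t - u) * om u <= (t - u) * om t by rewrite ler_wpM2l// subr_ge0.
have h6 : 0 <= (om t - om u) * (2 * u - t).
  by rewrite mulr_ge0 ?subr_ge0//; lra.
nra.
Qed.

(** The assumption on [y] says [y <= |t| * om |t|]. Since [om] is monotone, [t * om t] is at most
    the integral of [om] over [[t, 2 * t]] for [t > 0], and that integral, called [q t], is C^1. *)
Lemma C1_majorant : exists eta deta : R -> R,
  [/\ forall t : R, is_derive t 1 eta (deta t), continuous deta, eta 0 = 0 /\ deta 0 = 0,
      forall t, 0 <= eta t &
      forall t y, (forall ab, S ab -> y <= ab.1 * `|t| + ab.2 * `|t| ^+ 2) -> y <= eta t].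
Proof.
have [H dH H0] := truncated_primitive om_continuous om_le0.
pose q t := H (2 * t) - H t.
have dq (t : R) : is_derive t 1 q (2 * om (2 * t) - om t).
  have d2 : is_derive t (1 : R) (fun t : R => 2 * t) 2.
    have -> : (fun t : R => 2 * t) = 2 *: (id : R -> R) by [].
    by apply: is_derive_eq; rewrite [LHS]mulr1.
  have dH2 : is_derive t (1 : R) (H \o (fun t => 2 * t)) (om (2 * t) * 2).
    exact: is_derive1_comp.
  by rewrite mulrC; exact: is_deriveB.
have q0 t : t <= 0 -> q t = 0.
  by move=> t0; rewrite /q !H0// ?subr0// mulr_ge0_le0.
have q_ge t : 0 < t -> t * om t <= q t.
  move=> t0; have t2 : t < 2 * t by rewrite ltr_pMl// ltr1n.
  have cH : {within `[t, 2 * t], continuous H}.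
    by apply: derivable_within_continuous => u _; case: (dH u).
  have [u] := MVT t2 (fun u _ => dH u) cH.
  rewrite in_itv/= => /andP[tu _]; rewrite -/(q t) => ->.
  have -> : 2 * t - t = t by ring.
  by rewrite mulrC ler_pM2r// om_mono// ltW.
have q_ge0 t : 0 <= q t.
  have [t0|t0] := leP t 0; first by rewrite q0.
  by rewrite (le_trans _ (q_ge _ t0))// mulr_ge0// ltW.
pose dqf t := 2 * om (2 * t) - om t.
have cdq : continuous dqf.
  have c2 : continuous (fun t : R => 2 * t) by by move=> t; exact: mulrl_continuous.
  have co2 : continuous (fun t : R => om (2 * t)).
    by move=> t; apply: (continuous_comp (@c2 t)); exact: om_continuous.
  move=> t; have h1 := cvgB (cvgMl_tmp (a := 2) (@co2 t)) (@om_continuous t).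
  exact: h1.
(* [q] vanishes for nonpositive arguments, so this sum is [q] at [|t|], written without the kink. *)
exists (fun t => q t + q (- t)), (fun t => dqf t - dqf (- t)); split.
- move=> t; have dN : is_derive t (1 : R) (-%R : R -> R) (-1) by exact: is_deriveNid.
  have dqN : is_derive t (1 : R) (q \o -%R) (- dqf (- t)).
    by rewrite -mulrN1; exact: is_derive1_comp (dq (- t)) dN.
  exact: (@is_deriveD _ _ _ q (q \o -%R) t 1 _ _ (dq t) dqN).
- have cN : continuous (fun t : R => dqf (- t)).
    move=> t; apply: (@continuous_comp R R R (fun t => - t) dqf); last exact: cdq.
    exact: opp_continuous.
  by move=> t; exact: (cvgB (@cdq t) (@cN t)).
- by rewrite oppr0 q0// addr0 subrr.
- by move=> t; rewrite addr_ge0.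
- move=> t y yS.
  have [t0|t0] := eqVneq `|t| 0.
    have [ab Sab _] := S_small ltr01; have := yS _ Sab.
    by rewrite t0 expr0n/= !mulr0 addr0 => /le_trans; apply; exact: addr_ge0.
  have tp : 0 < `|t| by rewrite normr_gt0 -normr_eq0.
  have yq : y <= q `|t|.
    apply: le_trans (q_ge _ tp); rewrite -ler_pdivrMl//; apply: om_glb => ab Sab.
    have /ltW/max_idPr -> := tp; rewrite ler_pdivrMl//.
    apply: (le_trans (yS _ Sab)); rewrite le_eqVlt; apply/orP; left; apply/eqP; ring.
  apply: (le_trans yq); have [?|?] := ger0P t.
    by rewrite lerDl.
  by rewrite lerDr.
Qed.
End Majorant.
End OneVariable.

(** * Extension by a bump function *)

Section MoreCalculus.
Context {R : realType}.

Lemma is_derive_coord n (x v : 'rV[R]_n) j :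
  is_derive x v (fun y : 'rV[R]_n => y ord0 j) (v ord0 j).
Proof.
apply: (derivable_line0 _ _ _ _).2.
have := is_derive_affine x v 0 j.
by under eq_fun do rewrite addrC.
Qed.

Lemma cvg_natSinv (V : normedModType R) (u : nat -> V) l :
  (forall j, `|l - u j| < j.+1%:R^-1) -> u k @[k --> \oo] --> l.
Proof.
move=> ul; apply/cvgrPdist_lt => e e0.
have := near_infty_natSinv_lt (PosNum e0); apply: filterS => k /=.
exact: lt_trans.
Qed.

Lemma norm_sub_continuous n (x : 'rV[R]_n) : continuous (fun y : 'rV[R]_n => `|y - x|).
Proof.
move=> y; apply: (@continuous_comp _ _ _ (fun y : 'rV[R]_n => y - x) (fun z => `|z|)).
  by apply: continuousB; [exact: cvg_id|exact: cst_continuous].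
exact: norm_continuous.
Qed.

Lemma compact_norm_le n (x : 'rV[R]_n) r : compact [set y | `|y - x| <= r].
Proof.
apply: bounded_closed_compact.
  exists (r + `|x|); split; first exact: num_real.
  move=> k rk y /= yr; rewrite -(subrK x y) (le_trans (ler_normD _ _))//.
  by rewrite (le_trans _ (ltW rk))// lerD2r.
apply: (@closed_comp _ _ (fun y : 'rV[R]_n => `|y - x|) [set t | t <= r]).
  by move=> y _; exact: norm_sub_continuous.
exact: closed_le.
Qed.

(** Stands in for the extraction of a convergent subsequence: the indices [k] need not increase with
    [j], it suffices that [j <= k]. *)
Lemma cluster_seq n (u : nat -> 'rV[R]_n) (A : set 'rV[R]_n) :
  compact A -> (forall k, A (u k)) ->
  exists2 v, A v & forall j, exists2 k, (j <= k)%N & `|v - u k| < j.+1%:R^-1.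
Proof.
move=> cA uA; have FA : (u k @[k --> \oo]) A by exists 0%N => // k _; exact: uA.
have [v [Av clv]] := cA _ _ FA.
exists v => // j.
have F1 : (u k @[k --> \oo]) [set u k | k in [set k | (j <= k)%N]].
  by exists j => // k /= jk; exists k.
have F2 : nbhs v (ball v j.+1%:R^-1) by apply: nbhsx_ballx; rewrite invr_gt0.
have [_ [[k jk <-] vk]] := clv _ _ F1 F2.
by exists k => //; move: vk; rewrite -ball_normE.
Qed.

End MoreCalculus.

Section Bump.
Context {R : realType} {n : nat} {M : smooth_manifold R n} (p : M) (c : chart R n M).
Hypotheses (ac : atlas c) (cp : chart_dom c p).

Section Extension.
Variables (phi dphi : 'I_n -> R -> R) (b db : R -> R) (rho : R).
Hypothesis rho_ge0 : 0 <= rho.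
Hypothesis rho_img : forall x, `|x - c p| <= rho -> (c @` chart_dom c) x.
Hypothesis dphiP : forall i (t : R), is_derive t 1 (phi i) (dphi i t).
Hypothesis dphi_cont : forall i, continuous (dphi i).
Hypothesis dbP : forall t : R, is_derive t 1 b (db t).
Hypothesis db_cont : continuous db.
Hypothesis b_out : forall t, rho <= `|t| -> b t = 0.

(** Only one-variable functions of the coordinates occur, so smoothness reduces to sums, products
    and compositions. In the maximum norm the product of the [b] vanishes at distance [rho] or more
    from [c p]. *)
Let Psi (x : 'rV[R]_n) := (\sum_i phi i (x ord0 i - c p ord0 i)) *
  \prod_i b (x ord0 i - c p ord0 i).

(** [tau] is there for transition maps: smoothness has to be checked in every chart of the atlas. *)
Let Ck1_Psi m (W : set 'rV[R]_m) (tau : 'rV[R]_m -> 'rV[R]_n) : open W ->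
  (forall j, Ck_on 1 W (fun x => tau x ord0 j)) -> Ck_on 1 W (Psi \o tau).
Proof.
move=> oW Ctau.
have Cj j : Ck_on 1 W (fun x => tau x ord0 j - c p ord0 j).
  exact: (Ck1_add oW (Ctau j) (Ck1_cst _ oW)).
apply: (Ck1_mul oW).
  by apply: (Ck1_sum oW) => j; exact: (Ck1_comp1 oW (dphiP j) (@dphi_cont j) (Cj j)).
by apply: (Ck1_prod oW) => j; exact: (Ck1_comp1 oW dbP db_cont (Cj j)).
Qed.

(** The extension by zero is C^1 because the chart domain and the complement of [K] are open and
    cover the manifold; [K] is closed, being compact in a Hausdorff space. *)
Lemma bump_extension : exists f : C1fun M, forall y, chart_dom c y -> f y = Psi (c y).
Proof.
pose f (y : M) := if pselect (chart_dom c y) then Psi (c y) else 0.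
have fE y : chart_dom c y -> f y = Psi (c y) by rewrite /f; case: pselect.
pose K := chart_inv c @` [set x | `|x - c p| <= rho].
have cK : closed K.
  apply: compact_closed; first exact: manifold_hausdorff.
  apply: continuous_compact; last exact: compact_norm_le.
  apply: continuous_in_subspaceT => x; rewrite inE => /rho_img; exact: chart_inv_cont.
have Kc : K `<=` chart_dom c.
  by move=> _ [x /rho_img[y cy <-] <-]; rewrite chart_mapK.
have f0 y : ~ K y -> f y = 0.
  rewrite /f; case: pselect => // cy Ky.
  have [i ri] : exists i, rho <= `|c y ord0 i - c p ord0 i|.
    apply/not_existsP => H; apply: Ky; exists (c y); last exact: chart_mapK.
    by apply: norm_le_coord => // i; rewrite !mxE leNgt; apply/negP => /ltW; exact: H.
  by rewrite /Psi [X in _ * X](bigD1 i)//= b_out// mul0r mulr0.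
have C1f : C1_on setT f.
  move=> d ad; rewrite setIT; apply: Ck1_local; first exact: chart_img_open.
  move=> _ [q dq <-]; have [cq|ncq] := pselect (chart_dom c q).
    pose W := d @` (chart_dom d `&` chart_dom c).
    have oW : open W by apply: chart_image_open; exact: chart_dom_open.
    exists W; split => //; first by exists q.
    apply: (@Ck1_eq _ _ _ (Psi \o (c \o chart_inv d)) _ oW); last first.
      by apply: (Ck1_Psi oW) => j; exact: (atlas_compatible ad ac 1%N j).
    by move=> _ [q' [dq' cq'] <-] /=; rewrite chart_mapK// fE.
  pose W := d @` (chart_dom d `&` ~` K).
  have oW : open W by apply: chart_image_open; exact: closed_openC.
  exists W; split => //; first by exists q => //; split => // /Kc.
  apply: (@Ck1_eq _ _ _ (fun=> 0) _ oW); last exact: Ck1_cst.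
  by move=> _ [q' [dq' Kq'] <-] /=; rewrite chart_mapK// f0.
by exists (MkC1fun C1f).
Qed.

(** At [c p] the sum in [Psi] is 0 and the product is 1, so the product rule leaves only the
    derivative of the sum. *)
Lemma bump_extension_deriv (f : M -> R) :
  (forall y, chart_dom c y -> f y = Psi (c y)) ->
  (forall i, phi i 0 = 0) -> b 0 = 1 ->
  forall v, dir_deriv (f \o chart_inv c) (c p) v = \sum_i v ord0 i * dphi i 0.
Proof.
move=> fE phi0 b0 v; apply: eq_bigr => i _; congr (_ * _).
have -> : 'D_(delta_mx ord0 i) (f \o chart_inv c) (c p) = 'D_(delta_mx ord0 i) Psi (c p).
  apply: near_eq_derive; have icp : (c @` chart_dom c) (c p) by exists p.
  apply: (near_open (chart_img_open (c := c)) icp) => _ [y cy <-] /=.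
  by rewrite chart_mapK// fE.
have Cj j : Ck_on 1 [set: 'rV[R]_n] (fun x => x ord0 j - c p ord0 j).
  apply: Ck1_add; [exact: openT| |exact: Ck1_cst openT].
  apply: (@Ck1_intro _ _ _ _ (fun i _ => (delta_mx ord0 i : 'rV[R]_n) ord0 j)).
  - exact: openT.
  - by move=> k x _; exact: is_derive_coord.
  - by move=> k x _; exact: cst_continuous.
pose F (x : 'rV[R]_n) := \sum_i phi i (x ord0 i - c p ord0 i).
pose B (x : 'rV[R]_n) := \prod_i b (x ord0 i - c p ord0 i).
have CB : Ck_on 1 [set: 'rV[R]_n] B.
  by apply: Ck1_prod => [|j]; [exact: openT|exact: (Ck1_comp1 openT dbP)].
have dF : is_derive (c p) (delta_mx ord0 i) F (dphi i 0).
  have dj j : is_derive (c p) (delta_mx ord0 i)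
      (phi j \o (fun x : 'rV[R]_n => x ord0 j - c p ord0 j)) (dphi j 0 * (j == i)%:R).
    apply: is_derive_comp1; first by rewrite subrr.
    have dc : is_derive (c p) (delta_mx ord0 i : 'rV[R]_n)
      (fun x : 'rV[R]_n => x ord0 j - c p ord0 j) ((delta_mx ord0 i : 'rV[R]_n) ord0 j - 0).
      by apply: is_deriveB; exact: is_derive_coord.
    by move: dc; rewrite subr0 mxE eqxx.
  have -> : F = \sum_j (phi j \o (fun x : 'rV[R]_n => x ord0 j - c p ord0 j)).
    by apply/funext => x; rewrite fct_sumE.
  have -> : dphi i 0 = \sum_j dphi j 0 * (j == i)%:R.
    rewrite (bigD1 i)//= eqxx mulr1 big1 ?addr0// => j /negbTE->.
    by rewrite mulr0.
  exact: is_derive_sum.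
have dB := Ck1_derivable i CB (I : setT (c p)).
have [_ E] := is_deriveM dF dB.
have F0 : F (c p) = 0 by rewrite /F big1// => j _; rewrite subrr phi0.
have B1 : B (c p) = 1 by rewrite /B big1// => j _; rewrite subrr b0.
have -> : Psi = F * B by [].
by rewrite E F0 B1 scale0r add0r scale1r.
Qed.

End Extension.

End Bump.

(** * Realizing the polar of the tangent cone *)

Section PolarRealization.
Context {R : realType} {n : nat} {M : smooth_manifold R n} (p : M) (c : chart R n M).
Hypotheses (ac : atlas c) (cp : chart_dom c p).
Variable T : 'rV[R]_n -> tangent p.
Hypothesis TP : forall v s, T v s = dir_deriv (s \o chart_inv c) (c p) v.
Variables (Omega : set M) (w : 'rV[R]_n).

Let dot (v : 'rV[R]_n) : R := \sum_i v ord0 i * w ord0 i.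

Let dot_cont : continuous dot.
Proof.
move=> v; apply: continuous_at_sum => i; apply: continuousM; last exact: cst_continuous.
exact: coord_continuous.
Qed.

Let dotZ a v : dot (a *: v) = a * dot v.
Proof. by rewrite /dot mulr_sumr; apply: eq_bigr => i _; rewrite mxE mulrA. Qed.

Let dot_le v : dot v <= (\sum_i `|w ord0 i|) * `|v|.
Proof.
rewrite mulr_suml; apply: ler_sum => i _; apply: (le_trans (ler_norm _)).
by rewrite normrM mulrC ler_wpM2l// norm_coord_le.
Qed.

Hypothesis polarP : forall v, tangent_cone Omega (T v) -> dot v <= 0.

(** Otherwise points of [Omega] tend to [p] in the chart with [dot h > e * |h|]. Their normalized
    directions cluster at some [v], which lies in the tangent cone, and [dot v >= e] contradicts
    [polarP]. *)
Lemma dot_small e : 0 < e -> exists2 r : R, 0 < r & forall y, Omega y ->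
  chart_dom c y -> `|c y - c p| < r -> dot (c y - c p) <= e * `|c y - c p|.
Proof.
move=> e0; apply: contrapT => H.
have bad k : exists y, [/\ Omega y, chart_dom c y, `|c y - c p| < k.+1%:R^-1 &
    e * `|c y - c p| < dot (c y - c p)].
  apply: contrapT => Hk; apply: H; exists (k.+1%:R^-1); first by rewrite invr_gt0.
  by move=> y Oy cy yk; rewrite leNgt; apply/negP => ey; apply: Hk; exists y.
have [y yP] := choice bad.
pose h k := c (y k) - c p.
have h0 k : 0 < `|h k|.
  have [_ _ _ ] := yP k; rewrite -/(h k) normr_gt0 => hk; apply/eqP => hk0.
  by move: hk; rewrite hk0 -(scale0r (0 : 'rV[R]_n)) dotZ mul0r scale0r normr0 mulr0 ltxx.
pose u k := `|h k|^-1 *: h k.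
have u1 k : `|u k - 0| <= 1.
  by rewrite subr0 normrZ normfV normr_id mulVf// gt_eqF.
have [v _ /choice[K KP]] : exists2 v, `|v - 0| <= 1 &
    forall j, exists k, (j <= k)%N /\ `|v - u k| < j.+1%:R^-1.
  have [v v1 vP] := cluster_seq (@compact_norm_le R n 0 1) u1.
  by exists v => // j; have [k ? ?] := vP j; exists k.
have uv : u (K j) @[j --> \oo] --> v.
  by apply: cvg_natSinv => j; have [] := KP j.
have tj : `|h (K j)| @[j --> \oo] --> (0 : R).
  apply: cvg_natSinv => j; rewrite sub0r normrN normr_id.
  have [_ _ hk _] := yP (K j); apply: (lt_le_trans hk).
  by rewrite lef_pV2 ?posrE// ler_nat ltnS; have [] := KP j.
have Tv : tangent_cone Omega (T v).
  exists (y \o K), (fun j => `|h (K j)|).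
  have quot s := @difference_quotient_cvg _ _ _ p c ac cp (y \o K) (fun j => `|h (K j)|)
    v s (fun j => let: And4 _ a _ _ := yP (K j) in a) (fun j => h0 (K j)) tj uv.
  split.
  - by move=> j; have [] := yP (K j).
  (* The convergence of the points comes bundled with a function [s]; the constant 0 is a dummy for
     it. *)
  - have cst0 : C1_on (M := M) setT (fun=> 0 : R).
      by move=> d _; rewrite setIT; apply: Ck1_cst; exact: chart_img_open.
    exact: (quot (C1fun_near p (MkC1fun cst0))).1.
  - by split.
  - by move=> s; rewrite TP; exact: (quot s).2.
have := polarP Tv; rewrite leNgt => /negP; apply; apply: (lt_le_trans e0).
have du : dot (u (K j)) @[j --> \oo] --> dot v by exact: (continuous_cvg _ (@dot_cont v) uv).
apply: (closed_cvg (fun x : R => e <= x)) du; first exact: closed_ge.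
apply: nearW => j /=; have [_ _ _ hk] := yP (K j).
by rewrite dotZ ler_pdivlMl// mulrC ltW.
Qed.

(** With [h = c x - c p], the function is [\sum_i eta (h i) - dot h] times a bump. The derivative of
    [eta] vanishes at 0, and the sum dominates [dot h] on [Omega], so [f] is nonnegative there
    within the chart, and zero at [p]. *)
Lemma polar_minimizer : exists f : C1fun M,
  (forall v, dir_deriv (f \o chart_inv c) (c p) v = - dot v) /\
  exists2 U, nbhs p U & forall x, (U `&` Omega) x -> f p <= f x.
Proof.
pose S := [set ab : R * R | [/\ 0 <= ab.1, 0 <= ab.2 & forall y, Omega y -> chart_dom c y ->
  dot (c y - c p) <= ab.1 * `|c y - c p| + ab.2 * `|c y - c p| ^+ 2]].
have S_ge0 ab : S ab -> 0 <= ab.1 /\ 0 <= ab.2 by case.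
have S_small e : 0 < e -> exists2 ab, S ab & ab.1 <= e.
  move=> e0; have [r r0 rP] := dot_small e0.
  pose W := \sum_i `|w ord0 i|; have W0 : 0 <= W by apply: sumr_ge0.
  (* Within radius [r] the linear term suffices by [dot_small]; beyond it, [W * |h|] is at most
     [W / r] times the square of [|h|]. *)
  exists (e, W / r) => //; split => /=; [exact: ltW|by rewrite divr_ge0// ltW|].
  move=> y Oy cy; have [yr|ry] := ltP `|c y - c p| r.
    by apply: (le_trans (rP y Oy cy yr)); rewrite lerDl mulr_ge0// divr_ge0// ltW.
  apply: (le_trans (dot_le _)); rewrite -/W.
  apply: (@le_trans _ _ (W / r * `|c y - c p| ^+ 2)); last first.
    by rewrite lerDr mulr_ge0// ltW.
  rewrite expr2 mulrA ler_wpM2r// -mulrA ler_peMr// mulrC ler_pdivlMr// mul1r.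
  exact: ry.
have [eta [deta [dE cE [eta0 deta0] eta_ge0 etaP]]] := C1_majorant S_ge0 S_small.
have [H [dH H0 Hpos]] := @pos_part_primitive R.
have [r /= r0 rP] := (nbhs_ballP _ _).1 (chart_img_nbhs cp).
pose rho := r / 2.
have rho0 : 0 < rho by rewrite divr_gt0.
have rho_img x : `|x - c p| <= rho -> (c @` chart_dom c) x.
  move=> xr; apply: rP; rewrite -ball_normE/= distrC (le_lt_trans xr)//.
  by rewrite ltr_pdivrMr// ltr_pMr// ltr1n.
pose phi i (t : R) := eta t - w ord0 i * t.
pose dphi i (t : R) := deta t - w ord0 i.
(* The cutoff [b t] is [H (1 - (t / rho) ^+ 2) / H 1]: nonnegative, 1 at 0 and 0 for
   [|t| >= rho]. *)
pose k := (rho ^+ 2)^-1.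
pose a (t : R) := 1 - k * t ^+ 2.
pose b (t : R) := H (a t) / H 1.
pose db (t : R) := Num.max 0 (a t) * (- (k * (2 * t))) / H 1.
have k0 : 0 < k by rewrite invr_gt0 exprn_gt0.
have dphiP i (t : R) : is_derive t 1 (phi i) (dphi i t).
  have dl : is_derive t (1 : R) (fun t : R => w ord0 i * t) (w ord0 i).
    have -> : (fun t : R => w ord0 i * t) = w ord0 i *: (id : R -> R) by [].
    by apply: is_derive_eq; rewrite [LHS]mulr1.
  exact: is_deriveB.
have dphi_cont i : continuous (dphi i).
  by move=> t; apply: continuousB; [exact: cE|exact: cst_continuous].
have da (t : R) : is_derive t 1 a (- (k * (2 * t))).
  have -> : a = cst 1 - k *: (id : R -> R) ^+ 2 by [].
  apply: is_derive_eq; rewrite sub0r; congr (- _).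
  by rewrite [_%:A]mulr1 expr1.
have dbP (t : R) : is_derive t 1 b (db t).
  have dHa : is_derive t (1 : R) (H \o a) (Num.max 0 (a t) * (- (k * (2 * t)))).
    exact: is_derive1_comp.
  have -> : b = (H 1)^-1 *: (H \o a) by apply/funext => u; rewrite /b mulrC.
  by apply: is_derive_eq; rewrite /db [RHS]mulrC.
have db_cont : continuous db.
  have c1 : continuous (fun t : R => k * (2 * t)).
    have -> : (fun t : R => k * (2 * t)) = *%R (k * 2) by apply/funext => t; rewrite mulrA.
    by move=> t; exact: mulrl_continuous.
  have ca : continuous a.
    by move=> t; have [/derivable1_diffP/differentiable_continuous] := da t.
  have cm : continuous (fun t => Num.max 0 (a t)).
    move=> t; apply: (@continuous_comp R R R a (fun t => Num.max 0 t)); first exact: ca.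
    exact: pos_part_continuous.
  by move=> t; exact: (cvgM (cvgM (@cm t) (cvgN (@c1 t))) (cvg_cst _)).
have b_out t : rho <= `|t| -> b t = 0.
  move=> rt; rewrite /b H0 ?mul0r// subr_le0 mulrC ler_pdivlMr ?exprn_gt0// mul1r.
  by rewrite -(real_normK (num_real t)) lerXn2r// nnegrE ltW.
have b_ge0 t : 0 <= b t.
  rewrite divr_ge0 ?(ltW (Hpos _ ltr01))//.
  by have [/H0->|/Hpos/ltW] := leP (a t) 0.
have b01 : b 0 = 1.
  by rewrite /b /a expr0n/= mulr0 subr0 divff// gt_eqF// Hpos.
have [f fE] := bump_extension ac (ltW rho0) rho_img dphiP dphi_cont dbP db_cont b_out.
exists f; split.
  move=> v; rewrite (bump_extension_deriv cp dphiP dbP db_cont fE) //.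
    rewrite /dot -sumrN; apply: eq_bigr => i _.
    by rewrite /dphi deta0 sub0r mulrN.
  by move=> i; rewrite /phi eta0 mulr0 subrr.
exists (chart_dom c).
  by apply: open_nbhs_nbhs; split => //; exact: chart_dom_open.
move=> x [cx Ox]; rewrite !fE//.
rewrite [X in X * _]big1 ?mul0r; last first.
  by move=> i _; rewrite subrr /phi eta0 mulr0 subrr.
rewrite mulr_ge0 ?prodr_ge0//.
set h := c x - c p.
have hE i : c x ord0 i - c p ord0 i = h ord0 i by rewrite !mxE.
under eq_bigr do rewrite hE.
rewrite sumrB subr_ge0; under eq_bigr do rewrite mulrC; rewrite -/(dot h).
have [h0|h0] := eqVneq h 0.
  by rewrite h0 -(scale0r (0 : 'rV[R]_n)) dotZ mul0r sumr_ge0.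
have hn : mx_norm h != 0 by rewrite -[mx_norm h]/`|h| normr_eq0.
(* Some coordinate of [h] attains the norm; its [eta] term alone dominates [dot h], and the other
   terms are nonnegative. *)
have [[i0 i]] := mx_norm_neq0 hn; rewrite (ord1 i0)/= => hi.
apply: (@le_trans _ _ (eta (h ord0 i))).
  by apply: etaP => ab [_ _ abP]; rewrite -hi; exact: abP.
by rewrite (bigD1 i)//= lerDl sumr_ge0.
Qed.

End PolarRealization.

(** * Multipliers by penalization *)

Section Penalty.
Context {R : realType} {n : nat}.

Lemma Ck1_dir_continuous (U : set 'rV[R]_n) f x v : Ck_on 1 U f -> U x ->
  {for x, continuous (fun y => dir_deriv f y v)}.
Proof.
move=> Cf Ux; apply: continuous_at_sum => i; apply: continuousM.
  exact: cst_continuous.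
exact: Ck1_cvg_partial i Cf Ux.
Qed.

Lemma Ck1_is_derive_dir (U : set 'rV[R]_n) f x v : open U -> Ck_on 1 U f -> U x ->
  is_derive x v f (dir_deriv f x v).
Proof.
move=> oU Cf Ux; have [df Ef] := Ck1_differentiable oU Cf Ux.
by split; [exact: diff_derivable|rewrite deriveE// Ef].
Qed.

Lemma is_derive_interior_min (f : 'rV[R]_n -> R) z v d r :
  0 < r -> (forall y, `|y - z| < r -> f z <= f y) ->
  (forall y, `|y - z| < r -> derivable f y v) ->
  is_derive z v f d -> d = 0.
Proof.
move=> r0 zmin df [_ <-].
have v1 : 0 < `|v| + 1 by rewrite ltr_wpDl.
pose e := r / (`|v| + 1).
have e0 : 0 < e by rewrite divr_gt0.
have near_z (t : R) : t \in `](- e), e[ -> `|z + t *: v - z| < r.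
  rewrite in_itv/= -ltr_norml => te; rewrite addrAC subrr add0r normrZ.
  apply: (@le_lt_trans _ _ (`|t| * (`|v| + 1))); first by rewrite ler_wpM2l// lerDl.
  by rewrite -ltr_pdivlMr.
have ee : - e <= e by lra.
have d1 (t : R) : t \in `](- e), e[ -> derivable (fun u : R => f (z + u *: v)) t 1.
  by move=> te; have [] := @is_derive_line _ _ f z v t (df _ (near_z t te)).
have e00 : (0 : R) \in `](- e), e[ by rewrite in_itv/= oppr_lt0 e0.
have m1 (t : R) : t \in `](- e), e[ -> f (z + 0 *: v) <= f (z + t *: v).
  by move=> te; rewrite scale0r addr0; apply: zmin; exact: near_z.
have [_ E0] := derive1_at_min ee d1 e00 m1.
have z0 : z + 0 *: v = z by rewrite scale0r addr0.
have dz : derivable f (z + 0 *: v) v by apply: df; rewrite z0 subrr normr0.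
have [_ E1] := is_derive_line dz.
by move: E1; rewrite E0 z0.
Qed.

Variables (U : set 'rV[R]_n) (x0 : 'rV[R]_n) (phi : 'rV[R]_n -> R).
Variables (K : finType) (psi : K -> 'rV[R]_n -> R) (th dth : K -> R -> R).
Hypotheses (oU : open U) (Ux0 : U x0) (Cphi : Ck_on 1 U phi).
Hypotheses (Cpsi : forall k, Ck_on 1 U (psi k)) (psi0 : forall k, psi k x0 = 0).
Hypotheses (dthP : forall k (t : R), is_derive t 1 (th k) (dth k t)).
Hypotheses (dth_cont : forall k, continuous (dth k)).
Hypotheses (th_ge0 : forall k t, 0 <= th k t) (th0 : forall k, th k 0 = 0).
Hypothesis x0_min : forall x, U x -> (forall k, th k (psi k x) = 0) -> phi x0 <= phi x.

(** A proximal term: it forces the minimizers of the penalized functions towards [x0], although [x0]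
    need not be a strict minimizer of [phi]. *)
Let sq (x : 'rV[R]_n) : R := \sum_i (x ord0 i - x0 ord0 i) ^+ 2 / 2.
Let pen (x : 'rV[R]_n) : R := \sum_k th k (psi k x).
Let P (N : R) (x : 'rV[R]_n) := phi x + sq x + N * pen x.

Let sq_ge0 x : 0 <= sq x.
Proof. by apply: sumr_ge0 => i _; rewrite divr_ge0// sqr_ge0. Qed.

Let pen_ge0 x : 0 <= pen x.
Proof. exact: sumr_ge0. Qed.

Let Px0 N : P N x0 = phi x0.
Proof.
rewrite /P /sq /pen big1 ?addr0; last by move=> i _; rewrite subrr expr0n/= mul0r.
by rewrite big1 ?mulr0 ?addr0// => k _; rewrite psi0 th0.
Qed.

Let Csq : Ck_on 1 U sq.
Proof.
apply: (Ck1_sum oU) => i.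
apply: (@Ck1_comp1 _ _ _ (fun x => x ord0 i - x0 ord0 i) _ _ oU is_derive_half_sqr).
  by move=> t; exact: cvg_id.
apply: (Ck1_add oU); last exact: Ck1_cst.
apply: (@Ck1_intro _ _ _ _ (fun j _ => (delta_mx ord0 j : 'rV[R]_n) ord0 i) oU).
  by move=> j x _; exact: is_derive_coord.
by move=> j x _; exact: cst_continuous.
Qed.

Let Cpen : Ck_on 1 U pen.
Proof. by apply: (Ck1_sum oU) => k; exact: (Ck1_comp1 oU (dthP k) (@dth_cont k) (Cpsi k)). Qed.

Let CP N : Ck_on 1 U (P N).
Proof.
exact: (Ck1_add oU (Ck1_add oU Cphi Csq) (Ck1_mul oU (Ck1_cst N oU) Cpen)).
Qed.

Let dP N x v : U x -> is_derive x v (P N) (dir_deriv phi x v +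
  \sum_i (x ord0 i - x0 ord0 i) * v ord0 i +
  \sum_k (N * dth k (psi k x)) * dir_deriv (psi k) x v).
Proof.
move=> Ux; have dphi := Ck1_is_derive_dir v oU Cphi Ux.
have dsq : is_derive x v sq (\sum_i (x ord0 i - x0 ord0 i) * v ord0 i).
  have -> : sq = \sum_i ((fun t : R => t ^+ 2 / 2) \o (fun y : 'rV[R]_n => y ord0 i - x0 ord0 i)).
    by apply/funext => y; rewrite fct_sumE.
  apply: is_derive_sum => i; apply: is_derive_comp1; first exact: is_derive_half_sqr.
  rewrite -[v ord0 i]subr0; apply: is_deriveB; exact: is_derive_coord.
have dpen : is_derive x v pen (\sum_k dth k (psi k x) * dir_deriv (psi k) x v).
  rewrite /pen; elim: (index_enum K) => [|k s IH].
    rewrite big_nil; under eq_fun do rewrite big_nil; exact: is_derive_cst.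
  rewrite big_cons; under eq_fun do rewrite big_cons.
  apply: is_deriveD => //; apply: is_derive_comp1.
  exact: Ck1_is_derive_dir v oU (Cpsi k) Ux.
have -> : \sum_k (N * dth k (psi k x)) * dir_deriv (psi k) x v =
    N *: \sum_k dth k (psi k x) * dir_deriv (psi k) x v.
  by rewrite scaler_sumr; apply: eq_bigr => k _; rewrite [RHS]mulrA.
have -> : P N = phi + sq + N *: pen by [].
exact: is_deriveD.
Qed.

(** For large [N] the function [P N] exceeds [phi x0 = P N x0] on a small sphere around [x0], so its
    minimum over the closed ball is attained in the interior, where the derivative vanishes. *)
Lemma penalty_stationary e : 0 < e -> exists (x : 'rV[R]_n) (N : R),
  [/\ U x, `|x - x0| < e, 0 <= N & forall v, dir_deriv phi x v +
    \sum_i (x ord0 i - x0 ord0 i) * v ord0 i +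
    \sum_k (N * dth k (psi k x)) * dir_deriv (psi k) x v = 0].
Proof.
move=> e0; have [r /= r0 rU] := (nbhs_ballP _ _).1 (open_nbhs_nbhs (conj oU Ux0)).
pose d := Num.min e r / 2.
have d0 : 0 < d by rewrite divr_gt0// lt_min e0 r0.
have dm : d < Num.min e r by rewrite ltr_pdivrMr// ltr_pMr ?ltr1n// lt_min e0 r0.
have [de dr] : d < e /\ d < r by move: dm; rewrite lt_min => /andP.
have dU x : `|x - x0| <= d -> U x.
  move=> xd; apply: rU; rewrite -ball_normE/= distrC; exact: le_lt_trans xd dr.
(* If no [N] works, the violating points cluster at some [v] on the sphere with [P N v <= phi x0]
   for all [N]. Then [pen v = 0], hence [phi x0 <= phi v], hence [sq v = 0] and [v = x0], which is
   not on the sphere. *)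
have [N NP] : exists N : nat, forall x, `|x - x0| = d -> phi x0 < P N%:R x.
  apply: contrapT => H.
  have /choice[x xP] (N : nat) : exists x, `|x - x0| = d /\ P N%:R x <= phi x0.
    apply: contrapT => HN; apply: H; exists N => x xd; rewrite ltNge; apply/negP => Px.
    by apply: HN; exists x.
  have csph : compact [set y : 'rV[R]_n | `|y - x0| = d].
    have -> : [set y : 'rV[R]_n | `|y - x0| = d] =
       [set y | `|y - x0| <= d] `&` [set y | d <= `|y - x0|].
      apply/seteqP; split => y /=; first by move=> ->.
      by move=> [h1 h2]; apply/eqP; rewrite eq_le h1 h2.
    apply: compact_closedI; first exact: compact_norm_le.
    apply: (@closed_comp _ _ (fun y : 'rV[R]_n => `|y - x0|) [set t | d <= t]).
      by move=> y _; exact: norm_sub_continuous.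
    exact: closed_ge.
  have [v /= vd vP] := cluster_seq csph (fun k => (xP k).1).
  have Uv : U v by apply: dU; rewrite vd.
  have Pv (N : nat) : P N%:R v <= phi x0.
    rewrite leNgt; apply/negP => Pv.
    have := (CP N%:R).1 v Uv => /cvgrPdist_lt/(_ (P N%:R v - phi x0)).
    rewrite subr_gt0 => /(_ Pv) /nbhs_ballP[s /= s0 sP].
    have [j js] : exists j : nat, j.+1%:R^-1 < s.
      have [j _ jP] := near_infty_natSinv_lt (PosNum s0).
      by exists j; exact: jP j (leqnn j).
    have [k jk vk] := vP (maxn j N).
    have vks : ball v s (x k).
      rewrite -ball_normE/=; apply: (lt_trans vk); apply: le_lt_trans js.
      by rewrite lef_pV2 ?posrE// ler_nat ltnS leq_maxl.
    have := sP _ vks => /=; have := (xP k).2.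
    (* [P] increases with its parameter, so the bound at [x k] for the parameter [k] passes to the
       fixed [N <= k]. *)
    have : P N%:R (x k) <= P k%:R (x k).
      rewrite lerD2l ler_wpM2r// ler_nat; apply: leq_trans jk; exact: leq_maxr.
    move=> h1 h2 h3; have := ler_norm (P N%:R v - P N%:R (x k)); lra.
  have pen0 : pen v = 0.
    apply/eqP; rewrite eq_le pen_ge0 andbT leNgt; apply/negP => pv.
    have C0 : 0 <= phi x0 - phi v.
      by have := Pv 0%N; have := sq_ge0 v; rewrite /P mul0r; lra.
    have := archi_boundP (divr_ge0 C0 (ltW pv)).
    set N := Num.Def.archi_bound _; rewrite ltr_pdivrMr// => hN.
    by have := Pv N; have := sq_ge0 v; rewrite /P; lra.
  have feas k : th k (psi k v) = 0.
    by apply/eqP; have /eqP := pen0; rewrite psumr_eq0// => /allP/(_ k); apply; rewrite mem_index_enum.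
  have phiv := x0_min Uv feas.
  have sq0 : sq v = 0.
    apply/eqP; rewrite eq_le sq_ge0 andbT.
    by have := Pv 0%N; rewrite /P mul0r; lra.
  have vx0 : v = x0.
    apply/rowP => i; apply/eqP; rewrite -subr_eq0 -sqrf_eq0.
    have /eqP := sq0; rewrite psumr_eq0; last by move=> j _; rewrite divr_ge0// sqr_ge0.
    move=> /allP/(_ i); rewrite mem_index_enum => /(_ isT)/=.
    by rewrite mulf_eq0 invr_eq0 pnatr_eq0 orbF.
  by move: vd; rewrite vx0 subrr normr0 => d00; move: d0; rewrite -d00 ltxx.
pose B := [set y : 'rV[R]_n | `|y - x0| <= d].
have B0 : B !=set0 by exists x0; rewrite /B/= subrr normr0 ltW.
have cB : {within B, continuous (P N%:R)}.
  by apply: continuous_in_subspaceT => x; rewrite inE => /dU; exact: (CP _).1.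
have [z] := EVT_min_rV B0 (@compact_norm_le R n x0 d) cB.
rewrite inE /B/= => zd zmin.
have zd' : `|z - x0| < d.
  rewrite lt_neqAle zd andbT; apply/eqP => /NP; rewrite ltNge => /negP; apply.
  by rewrite -(Px0 N%:R); apply: zmin; rewrite inE /B/= subrr normr0 ltW.
have Uz := dU z zd.
exists z, N%:R; split => //; first exact: lt_trans zd' de.
move=> v; have r1 : 0 < d - `|z - x0| by rewrite subr_gt0.
have near_B y : `|y - z| < d - `|z - x0| -> `|y - x0| <= d.
  move=> yz; have := ler_distD z y x0; lra.
apply: (is_derive_interior_min r1 _ _ (dP N%:R v Uz)).
  by move=> y /near_B yB; apply: zmin; rewrite inE.
by move=> y /near_B/dU Uy; have [] := dP N%:R v Uy.
Qed.

(** The coefficients [N * dth k (psi k x)] at stationary points tending to [x0] are approximate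
    multipliers. Tested on the dual family, their linear system tends to the identity, so they
    converge, and their signs pass to the limit. *)
Lemma lagrange_multipliers (u : K -> 'rV[R]_n) :
  (forall l k, dir_deriv (psi k) x0 (u l) = (k == l)%:R) ->
  exists y : K -> R, (forall k, (forall t, 0 <= dth k t) -> 0 <= y k) /\
    forall v, dir_deriv phi x0 v + \sum_k y k * dir_deriv (psi k) x0 v = 0.
Proof.
move=> dual.
have /choice[x xP] (j : nat) : exists x, exists N : R,
  [/\ U x, `|x - x0| < j.+1%:R^-1, 0 <= N & forall v, dir_deriv phi x v +
    \sum_i (x ord0 i - x0 ord0 i) * v ord0 i +
    \sum_k (N * dth k (psi k x)) * dir_deriv (psi k) x v = 0].
  have j0 : 0 < j.+1%:R^-1 :> R by rewrite invr_gt0.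
  have [z [N H]] := penalty_stationary j0.
  by exists z, N.
have [N NP] := choice xP.
have xcvg : x j @[j --> \oo] --> x0.
  by apply: cvg_natSinv => j; rewrite distrC; have [] := NP j.
pose y j k := N j * dth k (psi k (x j)).
pose a v (z : 'rV[R]_n) := dir_deriv phi z v + \sum_i (z ord0 i - x0 ord0 i) * v ord0 i.
have acvg v : a v (x j) @[j --> \oo] --> dir_deriv phi x0 v.
  have -> : dir_deriv phi x0 v = a v x0.
    by rewrite /a big1 ?addr0// => i _; rewrite subrr mul0r.
  have ca : {for x0, continuous (a v)}.
    apply: continuousD; first exact: Ck1_dir_continuous Cphi Ux0.
    apply: continuous_at_sum => i; apply: continuousM; last exact: cst_continuous.
    by apply: continuousB; [exact: coord_continuous|exact: cst_continuous].
  exact: (continuous_cvg _ ca xcvg).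
have bcvg k v : dir_deriv (psi k) (x j) v @[j --> \oo] --> dir_deriv (psi k) x0 v.
  have cb : {for x0, continuous (fun z => dir_deriv (psi k) z v)}.
    exact: Ck1_dir_continuous (Cpsi k) Ux0.
  exact: (continuous_cvg _ cb xcvg).
have eqn j v : a v (x j) + \sum_k y j k * dir_deriv (psi k) (x j) v = 0.
  by have [_ _ _ H] := NP j; exact: H.
(* The deviation of that system from the identity. *)
pose m k l j := dir_deriv (psi k) (x j) (u l) - (k == l)%:R.
have mcvg k l : `|m k l j| @[j --> \oo] --> (0 : R).
  rewrite -(normr0 R); apply: cvg_norm; rewrite -(subrr (k == l)%:R) -{1}(dual l k).
  by apply: cvgB; [exact: bcvg|exact: cvg_cst].
have eqm j l : y j l + a (u l) (x j) = - \sum_k y j k * m k l j.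
  have := eqn j (u l).
  have -> : \sum_k y j k * dir_deriv (psi k) (x j) (u l) = \sum_k y j k * m k l j + y j l.
    rewrite [in RHS](eq_bigr (fun k => y j k * dir_deriv (psi k) (x j) (u l) - y j k * (k == l)%:R)).
      rewrite sumrB [X in _ - X + _](bigD1 l)//= eqxx mulr1 [X in _ - (_ + X) + _]big1 ?addr0 ?subrK//.
      by move=> k /negbTE ->; rewrite mulr0.
    by move=> k _; rewrite /m mulrBr.
  lra.
pose Y j := \sum_k `|y j k|.
pose A : R := \sum_l `|dir_deriv phi x0 (u l)| + 1.
(* Summing [eqm] over [l] bounds [Y j] by [A + Y j * \sum_k \sum_l |m k l j|] for large [j]; once
   the double sum is at most 1/2, the last term is absorbed. *)
have Ybound : \forall j \near \oo, Y j <= 2 * A.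
  have mc : \sum_k \sum_l `|m k l j| @[j --> \oo] --> (0 : R).
    have mk k : \sum_l `|m k l j| @[j --> \oo] --> (0 : R).
      have := cvg_sum_fin (fun l => mcvg k l); rewrite big1//; exact.
    have := cvg_sum_fin mk; rewrite big1//; exact.
  have ac : \sum_l `|a (u l) (x j)| @[j --> \oo] --> \sum_l `|dir_deriv phi x0 (u l)|.
    exact: (cvg_sum_fin (fun l => cvg_norm (acvg (u l)))).
  have n1 : \forall j \near \oo, \sum_k \sum_l `|m k l j| <= 2^-1.
    have half : 0 < 2^-1 :> R by [].
    have /cvgrPdist_le/(_ _ half) := mc; apply: filterS => j.
    by rewrite sub0r normrN; apply: le_trans; exact: ler_norm.
  have n2 : \forall j \near \oo, \sum_l `|a (u l) (x j)| <= A.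
    have /cvgrPdist_le/(_ _ ltr01) := ac; apply: filterS => j.
    rewrite distrC => h; have := le_trans (ler_norm _) h; rewrite /A; lra.
  apply: filterS (filterI n1 n2) => j [h1 h2].
  have Y1 : Y j <= \sum_l `|a (u l) (x j)| + Y j * \sum_k \sum_l `|m k l j|.
    have yl l : `|y j l| <= `|a (u l) (x j)| + \sum_k `|y j k| * `|m k l j|.
      have -> : y j l = - a (u l) (x j) - \sum_k y j k * m k l j.
        by rewrite -eqm; lra.
      apply: (le_trans (ler_normB _ _)); rewrite normrN lerD2l.
      by apply: (le_trans (ler_norm_sum _ _ _)); apply: ler_sum => k _; rewrite normrM.
    apply: (le_trans (ler_sum _ (fun l _ => yl l))); rewrite big_split/= lerD2l.
    rewrite exchange_big/= mulr_suml; apply: ler_sum => k _.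
    rewrite -mulr_sumr ler_wpM2l// [leRHS](bigD1 k)//= lerDl.
    by apply: sumr_ge0 => i _; exact: sumr_ge0.
  have Y0 : 0 <= Y j by exact: sumr_ge0.
  have : Y j * \sum_k \sum_l `|m k l j| <= Y j * 2^-1 by rewrite ler_wpM2l.
  lra.
have A0 : 0 < A by rewrite ltr_wpDl// sumr_ge0.
(* With the coefficients bounded, the right-hand side of [eqm] tends to 0. *)
have ycvg l : y j l @[j --> \oo] --> - dir_deriv phi x0 (u l).
  have rem : y j l + a (u l) (x j) @[j --> \oo] --> (0 : R).
    have ml : 2 * A * \sum_k `|m k l j| @[j --> \oo] --> (0 : R).
      have m0 : \sum_k `|m k l j| @[j --> \oo] --> (0 : R).
        have := cvg_sum_fin (fun k => mcvg k l); rewrite big1//; exact.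
      rewrite -[X in _ --> X](mulr0 (2 * A)); exact: cvgMl_tmp.
    apply/cvgrPdist_le => e e0; have /cvgrPdist_le/(_ _ e0) ml' := ml.
    apply: filterS (filterI Ybound ml') => j [hY]; rewrite !sub0r !normrN => h.
    apply: le_trans h; apply: le_trans (ler_norm _); rewrite eqm normrN.
    apply: (@le_trans _ _ (Y j * \sum_k `|m k l j|)); last by rewrite ler_wpM2r ?sumr_ge0.
    apply: (le_trans (ler_norm_sum _ _ _)); rewrite mulr_suml; apply: ler_sum => k _.
    rewrite normrM ler_wpM2l// [leRHS](bigD1 k)//= lerDl.
    exact: sumr_ge0.
  have -> : (fun j => y j l) = (fun j => y j l + a (u l) (x j)) - (fun j => a (u l) (x j)).
    by apply/funext => j; rewrite !fctE addrK.
  by rewrite -[- dir_deriv phi x0 (u l)]sub0r; apply: cvgB => //; exact: acvg.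
exists (fun k => - dir_deriv phi x0 (u k)); split=> [k dk|v].
  apply: (closed_cvg (fun t : R => 0 <= t)) (ycvg k); first exact: closed_ge.
  by apply: nearW => j; have [_ _ N0 _] := NP j; rewrite mulr_ge0.
have lim : a v (x j) + \sum_k y j k * dir_deriv (psi k) (x j) v @[j --> \oo] -->
    dir_deriv phi x0 v + \sum_k - dir_deriv phi x0 (u k) * dir_deriv (psi k) x0 v.
  apply: cvgD; first exact: acvg.
  exact: (cvg_sum_fin (fun k => cvgM (ycvg k) (bcvg k v))).
have lim0 : a v (x j) + \sum_k y j k * dir_deriv (psi k) (x j) v @[j --> \oo] --> (0 : R).
  by under eq_fun do rewrite eqn; exact: cvg_cst.
exact: cvg_unique lim lim0.
Qed.

End Penalty.

(** * Multipliers and constraint qualifications *)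

Lemma sum_subtype (R : nmodType) (I : finType) (P : pred I) (F : I -> R) :
  (forall i, ~~ P i -> F i = 0) ->
  \sum_i F i = \sum_(k : {i | P i}) F (val k).
Proof.
move=> F0; rewrite (bigID P)/= [X in _ + X]big1 ?addr0; last by move=> i /F0.
exact: (big_sub P F).
Qed.

(** At [t = (B + |a| + 1) / |b|] a nonzero slope would give an absolute value of at least
    [B + 1]. *)
Lemma affine_bounded_slope (R : realFieldType) (a b B : R) :
  (forall t, 0 <= t -> `|a + t * b| <= B) -> b = 0.
Proof.
move=> H; apply/eqP/negP => /negP b0.
have B0 : 0 <= B by apply: le_trans (H 0 (lexx _)).
have bp : 0 < `|b| by rewrite normr_gt0.
have t0 : 0 <= (B + `|a| + 1) / `|b| by rewrite divr_ge0// !addr_ge0.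
have := H _ t0; set t := _ / _ => h.
have tb : `|t * b| = B + `|a| + 1 by rewrite normrM ger0_norm// divfK// gt_eqF.
have := ler_normB (a + t * b) a; rewrite addrAC subrr add0r tb; lra.
Qed.

Section Multipliers.
Context {R : realType} {n : nat} {M : smooth_manifold R n}.
Context {m q : nat} (g : C1map M m) (h : C1map M q) (p : M).
Hypothesis hp : feasible g h p.
Variable c : chart R n M.
Hypotheses (ac : atlas c) (cp : chart_dom c p).
Variable T : 'rV[R]_n -> tangent p.
Hypothesis TP : forall v s, T v s = dir_deriv (s \o chart_inv c) (c p) v.
Hypothesis Tsurj : forall xi, exists v, xi = T v.

Let img := c @` chart_dom c.
Let oimg : open img. Proof. exact: chart_img_open. Qed.
Let imgp : img (c p). Proof. by exists p. Qed.

Let T_scalar s : scalar (fun v => T v s).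
Proof. by move=> a u v; rewrite !TP; exact: dir_deriv_scalar. Qed.

Let cotangent_scalar sigma : cotangent sigma -> scalar (fun v => sigma (T v)).
Proof.
move=> cs a u v; apply: cs; apply/funext => s; rewrite T_scalar.
by rewrite !fctE.
Qed.

Let C1fun_chart (f : C1fun M) : Ck_on 1 img (f \o chart_inv c).
Proof. by have := C1funP f ac; rewrite setIT. Qed.

(** Complementarity is one equation, but all summands [mu i * g i] are nonpositive, so each of them
    vanishes: [mu] is zero off the active set. *)
Lemma multipliersP (f : C1fun M) mu la : multipliers g h f p (mu, la) <->
  [/\ forall xi : tangent p, xi (C1fun_near p f) + \sum_i mu ord0 i * dg g i xi +
        \sum_j la ord0 j * dh h j xi = 0,
      forall i, 0 <= mu ord0 i & forall i, ~~ active g p i -> mu ord0 i = 0].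
Proof.
have fctE' (xi : tangent p) : (differential (C1fun_near p f)
   + \sum_i mu ord0 i *: dg (p := p) g i + \sum_j la ord0 j *: dh (p := p) h j) xi =
   xi (C1fun_near p f) + \sum_i mu ord0 i * dg g i xi + \sum_j la ord0 j * dh h j xi.
  by rewrite !fctE !fct_sumE.
have [gp hp0] := hp; split.
  case=> E _ mu0 _ mg; split => // [xi|i gi].
    by rewrite -fctE' E.
  have : (mu *m g p) ord0 ord0 = 0 by rewrite mg mxE.
  rewrite mxE => /eqP; rewrite -oppr_eq0 -sumrN psumr_eq0; last first.
    by move=> k _; rewrite oppr_ge0 mulr_ge0_le0.
  move=> /allP/(_ i); rewrite mem_index_enum => /(_ isT)/=.
  by rewrite oppr_eq0 mulf_eq0 => /orP[/eqP//|gi0]; rewrite /active gi0 in gi.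
case=> E mu0 muN; split => //.
  by apply/funext => xi; rewrite fctE' E.
apply/matrixP => i j; rewrite !ord1 !mxE big1// => k _.
have [/eqP ->|gk] := boolP (active g p k); first by rewrite mulr0.
by rewrite muN// mul0r.
Qed.

Let extend (a : {i : 'I_m | active g p i} -> R) : 'rV[R]_m :=
  \row_i (if insub i is Some k then a k else 0).

Let extendT a k : extend a ord0 (val k) = a k.
Proof. by rewrite mxE valK. Qed.

Let extendF a i : ~~ active g p i -> extend a ord0 i = 0.
Proof. by move=> ai; rewrite mxE insubF//; exact: negbTE. Qed.

Let sum_extend a (F : 'I_m -> R) :
  \sum_i extend a ord0 i * F i = \sum_k a k * F (val k).
Proof.
rewrite (@sum_subtype _ _ (active g p)).
  by apply: eq_bigr => k _; rewrite extendT.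
by move=> i ai; rewrite extendF// mul0r.
Qed.

Let multipliers_intro (f : C1fun M) (a : {i : 'I_m | active g p i} -> R) (b : 'I_q -> R) :
  (forall k, 0 <= a k) ->
  (forall v, T v (C1fun_near p f) + \sum_k a k * dg g (val k) (T v) +
     \sum_j b j * dh h j (T v) = 0) ->
  multipliers g h f p (extend a, \row_j b j).
Proof.
move=> a0 E; apply/multipliersP; split => [xi|i|i ai]; last exact: extendF.
  have [v ->] := Tsurj xi; rewrite -[RHS](E v) sum_extend; congr (_ + _).
  by apply: eq_bigr => j _; rewrite mxE.
have [ai|ai] := boolP (active g p i); last by rewrite extendF.
by rewrite -[i]/(val (exist _ i ai)) extendT.
Qed.

Let farkas_multipliers (f : C1fun M) :
  (forall v, (forall i, active g p i -> dg g i (T v) <= 0) ->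
     (forall j, dh h j (T v) = 0) -> 0 <= T v (C1fun_near p f)) ->
  multipliers g h f p !=set0.
Proof.
move=> H.
have lf : scalar (fun v => - T v (C1fun_near p f)).
  by move=> a u v; rewrite T_scalar; ring.
have [||v vg vh|a [b [a0 E]]] := @farkas _ _ {i : 'I_m | active g p i} 'I_q
  (fun k v => dg g (val k) (T v)) (fun j v => dh h j (T v)) _ _ _ lf.
- by move=> k; exact: T_scalar.
- by move=> j; exact: T_scalar.
- rewrite oppr_le0; apply: H => // i ai; exact: (vg (exist _ i ai)).
- exists (extend a, \row_j b j); apply: multipliers_intro => // v.
  by rewrite -addrA -E addrN.
Qed.

(** * Tangent cone, GCQ and existence of multipliers *)

Lemma tangent_cone_min (f : C1fun M) (xi : tangent p) :
  minimized_at g h p f -> tangent_cone (feasible g h) xi -> 0 <= xi (C1fun_near p f).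
Proof.
move=> [_ [U nU Umin]] [pk [tk [Opk pkp [tk0 _] lim]]].
have nq : \forall k \near \oo, 0 <= (f (pk k) - f p) / tk k.
  have nk : \forall k \near \oo, U (pk k) by exact: pkp.
  apply: filterS nk => k Uk.
  by rewrite divr_ge0 ?(ltW (tk0 k))// subr_ge0; apply: Umin; split => //; exact: Opk.
apply: (closed_cvg (fun t : R => 0 <= t)) (lim (C1fun_near p f)); first exact: closed_ge.
exact: nq.
Qed.

Lemma tangent_cone_linearizing (xi : tangent p) :
  tangent_cone (feasible g h) xi -> linearizing_cone g h xi.
Proof.
move=> [pk [tk [Opk pkp [tk0 _] lim]]]; split=> [i /eqP gi|j].
  apply: (closed_cvg (fun t : R => t <= 0)) (lim (C1fun_near p (component g i))).
    exact: closed_le.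
  apply: nearW => k /=; rewrite gi subr0 mulr_le0_ge0//; first exact: (Opk k).1.
  by rewrite invr_ge0 ltW.
apply: (closed_cvg (fun t : R => t = 0)) (lim (C1fun_near p (component h j))).
  exact: closed_eq.
by apply: nearW => k /=; rewrite (Opk k).2 hp.2 subrr mul0r.
Qed.

(** By minimality [-df] is in the polar of the tangent cone; GCQ moves it to the polar of the
    linearizing cone, where Farkas' lemma applies. *)
Lemma GCQ_multipliers (f : C1fun M) : GCQ g h p -> minimized_at g h p f ->
  multipliers g h f p !=set0.
Proof.
move=> gcq fmin.
pose sigma (xi : tangent p) : R := - xi (C1fun_near p f).
have cs : cotangent sigma.
  by move=> a xi eta zeta E; rewrite /sigma E !fctE /GRing.scale/=; ring.
have : polar (linearizing_cone g h (p := p)) sigma.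
  rewrite gcq; split => // xi Txi.
  by rewrite oppr_le0; exact: tangent_cone_min.
move=> [_ Lneg]; apply: farkas_multipliers => v vg vh.
by rewrite -oppr_le0; apply: (Lneg (T v)).
Qed.

Let sum_delta (F : 'rV[R]_n -> R) v : scalar F ->
  F v = \sum_i v ord0 i * F (delta_mx ord0 i).
Proof.
move=> lF; rewrite {1}[v]row_sum_delta.
elim: (index_enum _) => [|i s IH]; first by rewrite !big_nil scalar_fun0.
by rewrite !big_cons scalar_funD// scalar_funZ// IH.
Qed.

(** One inclusion of polars always holds, since the tangent cone lies in the linearizing cone. For
    the other, [polar_minimizer] realizes [sigma] as [-df], and the multipliers of [f] write [sigma]
    as a combination that is nonpositive on the linearizing cone. *)
Lemma multipliers_GCQ :
  (forall f : C1fun M, minimized_at g h p f -> multipliers g h f p !=set0) ->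
  GCQ g h p.
Proof.
move=> H; apply/seteqP; split => sigma [cs sneg]; split => // xi Lxi.
  exact/sneg/tangent_cone_linearizing.
pose w : 'rV[R]_n := \row_i sigma (T (delta_mx ord0 i)).
have sE v : sigma (T v) = \sum_i v ord0 i * w ord0 i.
  rewrite (sum_delta v (cotangent_scalar cs)).
  by apply: eq_bigr => i _; rewrite mxE.
have polarP v : tangent_cone (feasible g h) (T v) -> \sum_i v ord0 i * w ord0 i <= 0.
  by rewrite -sE; exact: sneg.
have [f [df [U nU Umin]]] := polar_minimizer ac cp TP polarP.
have [|[mu la]] := H f; first by split => //; exists U.
move=> /multipliersP[E mu0 muN].
have [v vE] := Tsurj xi.
have : sigma xi = \sum_i mu ord0 i * dg g i xi + \sum_j la ord0 j * dh h j xi.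
  by have := E xi; rewrite {1 4}vE sE TP df; lra.
move=> ->; rewrite [X in _ + X]big1 ?addr0; last by move=> j _; rewrite Lxi.2 mulr0.
apply: sumr_le0 => i _; have [ai|ai] := boolP (active g p i); last by rewrite muN// mul0r.
by rewrite mulr_ge0_le0//; exact: Lxi.1.
Qed.

(** * Compactness of the multiplier set and MFCQ *)

Let indep_T (K : finType) (F : K -> C1near p) :
  lin_independent (fun k => differential (F k)) ->
  forall a : K -> R, (forall v, \sum_k a k * T v (F k) = 0) -> forall k, a k = 0.
Proof.
move=> indep a E; apply: indep; apply/funext => xi; rewrite fct_sumE.
by have [v ->] := Tsurj xi; exact: E.
Qed.

(** The set is closed, as an intersection of closed conditions. At [xi0] the [dh] terms vanish and
    the active [dg i xi0] are negative, which bounds each [mu i] by [b i]; at [u j] the equation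
    isolates the [j]-th entry of [la]. *)
Lemma MFCQ_compact (f : C1fun M) : MFCQ g h p -> compact (multipliers g h f p).
Proof.
move=> [hindep [xi0 [xg xh]]].
have [u uP] := dual_family (fun j => T_scalar (C1fun_near p (component h j)))
   (indep_T (F := fun j => C1fun_near p (component h j)) hindep).
pose b i := `|xi0 (C1fun_near p f)| / `|dg g i xi0|.
pose B1 := \sum_i b i.
have b0 i : 0 <= b i by rewrite divr_ge0.
have B10 : 0 <= B1 by exact: sumr_ge0.
pose d j := `|T (u j) (C1fun_near p f)| + B1 * \sum_i `|dg g i (T (u j))|.
pose B2 := \sum_j d j.
have d0 j : 0 <= d j by rewrite addr_ge0// mulr_ge0// sumr_ge0.
have B20 : 0 <= B2 by exact: sumr_ge0.
apply: (@subclosed_compact _ _ ([set mu | `|mu - 0| <= B1] `*` [set la | `|la - 0| <= B2])).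
- have -> : multipliers g h f p =
     (\bigcap_(xi in [set: tangent p]) [set ml : 'rV[R]_m * 'rV[R]_q | xi (C1fun_near p f) +
        \sum_i ml.1 ord0 i * dg g i xi + \sum_j ml.2 ord0 j * dh h j xi = 0]) `&`
     (\bigcap_(i in [set: 'I_m]) [set ml : 'rV[R]_m * 'rV[R]_q | 0 <= ml.1 ord0 i]) `&`
     (\bigcap_(i in [set i | ~~ active g p i]) [set ml : 'rV[R]_m * 'rV[R]_q | ml.1 ord0 i = 0]).
    apply/seteqP; split => [[mu la] /multipliersP[E mu0 muN]|[mu la] [[E mu0] muN]].
      by split; [split => [xi _|i _]|move=> i]; [exact: E|exact: mu0|exact: muN].
    by apply/multipliersP; split => [xi|i|i]; [exact: E|exact: mu0|exact: muN].
  have c1 i : continuous (fun ml : 'rV[R]_m * 'rV[R]_q => ml.1 ord0 i).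
    move=> ml; apply: (@continuous_comp _ _ _ fst (fun mu : 'rV[R]_m => mu ord0 i)).
      exact: cvg_fst.
    exact: coord_continuous.
  have c2 j : continuous (fun ml : 'rV[R]_m * 'rV[R]_q => ml.2 ord0 j).
    move=> ml; apply: (@continuous_comp _ _ _ snd (fun la : 'rV[R]_q => la ord0 j)).
      exact: cvg_snd.
    exact: coord_continuous.
  apply: closedI; first apply: closedI.
  + apply: closed_bigI => xi _.
    pose E (ml : 'rV[R]_m * 'rV[R]_q) := xi (C1fun_near p f) +
      \sum_i ml.1 ord0 i * dg g i xi + \sum_j ml.2 ord0 j * dh h j xi.
    apply: (@closed_comp _ _ E [set t | t = 0]); last exact: closed_eq.
    move=> ml _.
    have s1 : {for ml, continuous (fun ml : 'rV[R]_m * 'rV[R]_q =>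
        \sum_i ml.1 ord0 i * dg g i xi)}.
      apply: continuous_at_sum => i; apply: continuousM; last exact: cst_continuous.
      exact: c1.
    have s2 : {for ml, continuous (fun ml : 'rV[R]_m * 'rV[R]_q =>
        \sum_j ml.2 ord0 j * dh h j xi)}.
      apply: continuous_at_sum => j; apply: continuousM; last exact: cst_continuous.
      exact: c2.
    exact: (cvgD (cvgD (cvg_cst _) s1) s2).
  + apply: closed_bigI => i _.
    apply: (@closed_comp _ _ (fun ml : 'rV[R]_m * 'rV[R]_q => ml.1 ord0 i) [set t | 0 <= t]).
      by move=> ml _; exact: c1.
    exact: closed_ge.
  + apply: closed_bigI => i _.
    apply: (@closed_comp _ _ (fun ml : 'rV[R]_m * 'rV[R]_q => ml.1 ord0 i) [set t | t = 0]).
      by move=> ml _; exact: c1.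
    exact: closed_eq.
- by apply: compact_setX; exact: compact_norm_le.
- move=> [mu la] /multipliersP[E mu0 muN].
  have mub i : mu ord0 i <= b i.
    have [ai|ai] := boolP (active g p i); last by rewrite muN.
    have gi := xg i ai; rewrite /b ler_pdivlMr ?normr_gt0 ?lt_eqF//.
    have := E xi0; rewrite [X in _ + X]big1 ?addr0; last by move=> j _; rewrite xh mulr0.
    rewrite (bigD1 i)//= => E0.
    have : \sum_(k | k != i) mu ord0 k * dg g k xi0 <= 0.
      apply: sumr_le0 => k _.
      have [ak|ak] := boolP (active g p k); last by rewrite muN// mul0r.
      by rewrite mulr_ge0_le0// ltW// xg.
    have := ler_norm (xi0 (C1fun_near p f)).
    rewrite (ltr0_norm gi) mulrN; lra.
  have muB i : `|mu ord0 i| <= B1.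
    rewrite ger0_norm// (le_trans (mub i))// /B1 (bigD1 i)//= lerDl.
    exact: sumr_ge0.
  split => /=; rewrite subr0; apply: norm_le_coord => // j.
  apply: (@le_trans _ _ (d j)); last by rewrite /B2 (bigD1 j)//= lerDl sumr_ge0.
  have := E (T (u j)).
  have -> : \sum_k la ord0 k * dh h k (T (u j)) = la ord0 j.
    rewrite (bigD1 j)//= /dh/differential uP eqxx mulr1 big1 ?addr0// => k kj.
    by rewrite uP (negbTE kj) mulr0.
  move=> Ej.
  have -> : la ord0 j = - T (u j) (C1fun_near p f) - \sum_i mu ord0 i * dg g i (T (u j)).
    by lra.
  apply: (le_trans (ler_normB _ _)); rewrite normrN lerD2l mulr_sumr.
  apply: (le_trans (ler_norm_sum _ _ _)); apply: ler_sum => i _.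
  by rewrite normrM ler_wpM2r.
Qed.

(** The ray from a multiplier in the direction [(a, b)] consists of multipliers, and a bounded set
    contains no ray with nonzero direction. *)
Lemma compact_no_recession (f : C1fun M) (a : {i : 'I_m | active g p i} -> R) (b : 'I_q -> R) :
  multipliers g h f p !=set0 -> compact (multipliers g h f p) ->
  (forall k, 0 <= a k) ->
  (forall v, \sum_k a k * dg g (val k) (T v) + \sum_j b j * dh h j (T v) = 0) ->
  (forall k, a k = 0) /\ (forall j, b j = 0).
Proof.
move=> [[mu la] /multipliersP[E mu0 muN]] /compact_bounded[B [_ HB]] a0 E0.
have B1 : B < B + 1 by rewrite ltrDl.
have ray (t : R) : 0 <= t ->
    multipliers g h f p (mu + t *: extend a, la + t *: \row_j b j).
  move=> t0; apply/multipliersP; split => [xi|i|i ai].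
  - have [v ->] := Tsurj xi.
    have := E (T v); have := E0 v; rewrite -(sum_extend a (fun i => dg g i (T v))).
    have -> : \sum_i (mu + t *: extend a) ord0 i * dg g i (T v) =
        \sum_i mu ord0 i * dg g i (T v) + t * \sum_i extend a ord0 i * dg g i (T v).
      rewrite mulr_sumr -big_split/=; apply: eq_bigr => i _.
      by rewrite 2!mxE mulrDl mulrA.
    have -> : \sum_j (la + t *: \row_j b j) ord0 j * dh h j (T v) =
        \sum_j la ord0 j * dh h j (T v) + t * \sum_j b j * dh h j (T v).
      rewrite mulr_sumr -big_split/=; apply: eq_bigr => i _.
      by rewrite !mxE mulrDl mulrA.
    move=> /eqP; rewrite addr_eq0 => /eqP ->; lra.
  - rewrite 2!mxE; apply: addr_ge0 => //; apply: mulr_ge0 => //.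
    have [ai|ai] := boolP (active g p i); last by rewrite extendF.
    by have := a0 (exist _ i ai); rewrite -extendT.
  - by rewrite 2!mxE muN// extendF// mulr0 addr0.
have bd t : 0 <= t -> `|mu + t *: extend a| <= B + 1 /\ `|la + t *: \row_j b j| <= B + 1.
  move=> /ray /(HB _ B1)/=; rewrite prod_normE/= ge_max => /andP[]//.
split=> [k|j].
  apply: (@affine_bounded_slope _ (mu ord0 (val k)) _ (B + 1)) => t /bd[h1 _].
  by apply: le_trans (le_trans (norm_coord_le _ (val k)) h1); rewrite 2!mxE extendT.
apply: (@affine_bounded_slope _ (la ord0 j) _ (B + 1)) => t /bd[_ h2].
by apply: le_trans (le_trans (norm_coord_le _ j) h2); rewrite !mxE.
Qed.

(** Both failures of MFCQ are excluded by [compact_no_recession]: a dependence among the [dh] is a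
    direction [(0, b)], and if no [xi] exists, [motzkin] gives a direction whose [a] sums to 1. *)
Lemma compact_MFCQ (f : C1fun M) :
  multipliers g h f p !=set0 -> compact (multipliers g h f p) -> MFCQ g h p.
Proof.
move=> ne cL; split.
  move=> b Eb; apply: (compact_no_recession ne cL (a := fun=> 0) _ _).2 => // v.
  rewrite big1 ?add0r; last by move=> k _; rewrite mul0r.
  by have := congr1 (@^~ (T v)) Eb; rewrite /= fct_sumE.
apply: contrapT => H.
have [||[v [vg vh]]|a [b [a0 a1 E]]] := @motzkin _ _ {i : 'I_m | active g p i} 'I_q
  (fun k v => dg g (val k) (T v)) (fun j v => dh h j (T v)).
- by move=> k; exact: T_scalar.
- by move=> j; exact: T_scalar.
- by apply: H; exists (T v); split => // i ai; exact: (vg (exist _ i ai)).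
- have [az _] := compact_no_recession ne cL a0 E.
  by move: a1; rewrite big1// => /esym/eqP; rewrite oner_eq0.
Qed.

(** * Uniqueness of the multiplier and LICQ *)

Let acts := {i : 'I_m | active g p i}.
Let cstr (k : 'I_q + acts) : C1fun M :=
  match k with inl j => component h j | inr i => component g (val i) end.

Let LICQ_indep : LICQ g h p <->
  forall a : 'I_q + acts -> R,
  (forall v, \sum_k a k * T v (C1fun_near p (cstr k)) = 0) -> forall k, a k = 0.
Proof.
have vE : (fun k : 'I_q + acts => differential (C1fun_near p (cstr k))) =
  (fun k => match k with inl j => dh (p := p) h j | inr i => dg (p := p) g (val i) end).
  by apply/funext => -[].
split=> [|H].
  by rewrite /LICQ -vE => licq; exact: indep_T.
rewrite /LICQ -vE => a Ea; apply: H => v.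
by have := congr1 (@^~ (T v)) Ea; rewrite /= fct_sumE.
Qed.

Lemma LICQ_multipliers (f : C1fun M) : LICQ g h p -> minimized_at g h p f ->
  multipliers g h f p !=set0.
Proof.
move=> /LICQ_indep indep [_ [U nU Umin]].
have [u uP] := dual_family (fun k => T_scalar (C1fun_near p (cstr k))) indep.
have icont : {for c p, continuous (chart_inv c)} by apply: chart_inv_cont imgp.
(* Inactive constraints stay negative near [p], so only the active ones need a penalty. *)
have nW : nbhs (c p) [set x | [/\ img x, U (chart_inv c x) &
    forall i, ~~ active g p i -> g (chart_inv c x) i ord0 < 0]].
  have n1 : nbhs (c p) img by exact: open_nbhs_nbhs.
  have n2 : nbhs (c p) (chart_inv c @^-1` U) by apply: icont; rewrite chart_mapK.
  have n3 : \forall x \near c p, forall i, ~~ active g p i -> g (chart_inv c x) i ord0 < 0.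
    apply: (filter_forall (nbhs_filter (c p))) => i.
    have [ai|ai] := boolP (active g p i).
      by apply: (near_open (@openT _) (I : setT (c p))) => x _; rewrite ?ai.
    have gi : g p i ord0 < 0 by rewrite lt_neqAle ai hp.1.
    have cg := (C1fun_chart (component g i)).1 _ imgp.
    have ng : nbhs ((component g i \o chart_inv c) (c p)) [set t : R | t < 0].
      by apply: open_nbhs_nbhs; split; [exact: open_lt|rewrite /= chart_mapK].
    have nx : \forall x \near c p, g (chart_inv c x) i ord0 < 0 by exact: cg ng.
    by apply: (filterS _ nx) => x gx _.
  by apply: (filterS _ (filterI n1 (filterI n2 n3))) => x [? [? ?]].
have [r /= r0 rP] := (nbhs_ballP _ _).1 nW.
pose W := ball (c p) r.
have oW : open W by exact: ball_open.
have Wp : W (c p) by exact: ballxx.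
have CW (s : C1fun M) : Ck_on 1 W (s \o chart_inv c).
  by apply: Ck1_subset (C1fun_chart s) => x /rP[].
have [H [dH H0 Hpos]] := @pos_part_primitive R.
(* For inequalities the derivative of the penalty is a positive part, which makes the limiting [mu]
   nonnegative; for equalities it takes both signs. *)
pose th (k : 'I_q + acts) (t : R) : R := match k with inl _ => t ^+ 2 / 2 | inr _ => H t end.
pose dth (k : 'I_q + acts) (t : R) : R := match k with inl _ => t | inr _ => Num.max 0 t end.
have dthP k (t : R) : is_derive t 1 (th k) (dth k t).
  by case: k => [j|k]; [exact: is_derive_half_sqr|exact: dH].
have dth_cont k : continuous (dth k).
  by case: k => [j|k]; [move=> t; exact: cvg_id|exact: pos_part_continuous].
have th_ge0 k t : 0 <= th k t.
  case: k => [j|k] /=; first by rewrite divr_ge0// sqr_ge0.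
  by have [/H0->|/Hpos/ltW] := leP t 0.
have th0 k : th k 0 = 0 by case: k => [j|k] /=; [rewrite expr0n/= mul0r|exact: H0].
have cstr0 k : (cstr k \o chart_inv c) (c p) = 0.
  rewrite /= chart_mapK//; case: k => [j|k] /=; first by rewrite hp.2 mxE.
  by case: k => i /= /eqP.
have wmin x : W x -> (forall k, th k ((cstr k \o chart_inv c) x) = 0) ->
    (f \o chart_inv c) (c p) <= (f \o chart_inv c) x.
  move=> /rP[_ Ux gx] thx; rewrite /= chart_mapK//; apply: Umin; split => //; split.
    move=> i; have [ai|ai] := boolP (active g p i); last exact/ltW/gx.
    rewrite leNgt; apply/negP => /Hpos.
    by have := thx (inr (exist _ i ai)) => /= ->; rewrite ltxx.
  apply/colP => j; rewrite mxE; have := thx (inl j) => /=.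
  by move=> /eqP; rewrite mulf_eq0 invr_eq0 pnatr_eq0 orbF expf_eq0/= => /eqP.
have dual l k : dir_deriv (cstr k \o chart_inv c) (c p) (u l) = (k == l)%:R.
  by rewrite -(uP l k) TP.
have [y [y0 E]] := lagrange_multipliers oW Wp (CW f) (fun k => CW (cstr k)) cstr0
  dthP dth_cont th_ge0 th0 wmin dual.
exists (extend (fun k => y (inr k)), \row_j y (inl j)); apply: multipliers_intro => [k|v].
  by apply: y0 => t; rewrite /= le_max lexx.
rewrite -[RHS](E v) big_sumType/= -addrA [X in _ + X]addrC TP; congr (_ + (_ + _)).
  by apply: eq_bigr => j _; rewrite /dh/differential TP.
by apply: eq_bigr => j _; rewrite /dg/differential TP.
Qed.

(** The difference of two multipliers lives on the active set and is a vanishing combination of the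
    family in LICQ. *)
Lemma LICQ_unique (f : C1fun M) ml1 ml2 : LICQ g h p ->
  multipliers g h f p ml1 -> multipliers g h f p ml2 -> ml1 = ml2.
Proof.
move: ml1 ml2 => [mu1 la1] [mu2 la2] /LICQ_indep indep.
move=> /multipliersP[E1 _ N1] /multipliersP[E2 _ N2].
pose a (k : 'I_q + acts) : R := match k with
  inl j => la1 ord0 j - la2 ord0 j | inr i => mu1 ord0 (val i) - mu2 ord0 (val i) end.
have a0 : forall k, a k = 0.
  apply: indep => v; have := E1 (T v); have := E2 (T v).
  rewrite (@sum_subtype _ _ (active g p)); last by move=> i ai; rewrite N2// mul0r.
  rewrite (@sum_subtype _ _ (active g p) (fun i => mu1 ord0 i * _)); last first.
    by move=> i ai; rewrite N1// mul0r.
  rewrite big_sumType/=.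
  under [X in _ -> _ -> X + _ = _]eq_bigr do rewrite mulrBl.
  under [X in _ -> _ -> _ + X = _]eq_bigr do rewrite mulrBl.
  rewrite !sumrB /dg /dh /differential; lra.
congr (_, _); apply/rowP => i; apply/eqP; rewrite -subr_eq0.
  have [ai|ai] := boolP (active g p i); last by rewrite N1// N2// subrr.
  by apply/eqP; exact: (a0 (inr (exist _ i ai))).
by apply/eqP; exact: (a0 (inl i)).
Qed.

(** A vanishing combination [a], scaled down by [t], can be added to the multiplier that is 1 on the
    active set without losing nonnegativity; uniqueness then forces [a = 0]. *)
Lemma unique_LICQ :
  (forall f : C1fun M, minimized_at g h p f ->
     exists ml, multipliers g h f p = [set ml]) -> LICQ g h p.
Proof.
move=> uniq.
pose ind i : R := (active g p i)%:R.
have Cf : C1_on (M := M) setT (fun x => \sum_i - ind i * g x i ord0).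
  move=> d ad; have od := chart_img_open (c := d); rewrite setIT.
  apply: (Ck1_sum od) => i; apply: (Ck1_mul od (Ck1_cst _ od)).
  by have := C1funP (component g i) ad; rewrite setIT.
pose f := MkC1fun Cf.
have fmin : minimized_at g h p f.
  split => //; exists setT; first exact: filterT.
  move=> x [_ [gx _]] /=; apply: (@le_trans _ _ 0).
    rewrite big1// => i _; rewrite /ind; case: (boolP (active g p i)) => [/eqP ->|_].
      by rewrite mulr0.
    by rewrite oppr0 mul0r.
  apply: sumr_ge0 => i _; rewrite mulNr oppr_ge0 mulr_ge0_le0//.
have fE v : T v (C1fun_near p f) = \sum_i - ind i * dg g i (T v).
  rewrite TP.
  have [_ <-] := Ck1_is_derive_dir v oimg (C1fun_chart f) imgp.
  have -> : f \o chart_inv c = \sum_i (- ind i *: (component g i \o chart_inv c)).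
    by apply/funext => x; rewrite fct_sumE.
  have di i : is_derive (c p) v (component g i \o chart_inv c) (dg g i (T v)).
    rewrite /dg/differential TP; exact: Ck1_is_derive_dir v oimg (C1fun_chart _) imgp.
  by have [_ ->] := is_derive_sum (fun i => is_deriveZ (- ind i) (di i)).
have [ml mlE] := uniq f fmin.
have in1 : multipliers g h f p (\row_i ind i, 0).
  apply/multipliersP; split => [xi|i|i /negbTE ai].
  - have [v ->] := Tsurj xi; rewrite fE -big_split/= !big1 ?addr0// => i _; rewrite mxE.
      by rewrite mul0r.
    by rewrite mulNr addNr.
  - by rewrite mxE.
  - by rewrite mxE /ind ai.
apply/LICQ_indep => a Ea.
pose s : R := \sum_k `|a k|.
have s0 : 0 <= s by exact: sumr_ge0.
have s1 : 0 < 1 + s by rewrite ltr_pwDl.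
(* This scaling ensures [|t * a k| <= 1], so that [1 + t * a k] is nonnegative. *)
pose t := (1 + s)^-1.
have t0 : 0 < t by rewrite invr_gt0.
have ta k : - 1 <= t * a k.
  have : `|t * a k| <= 1.
    rewrite normrM gtr0_norm// mulrC ler_pdivrMr// mul1r /s (bigD1 k)//=.
    by rewrite addrCA lerDl addr_ge0// sumr_ge0.
  by rewrite ler_norml => /andP[].
have in2 : multipliers g h f p (extend (fun k => 1 + t * a (inr k)), \row_j (t * a (inl j))).
  apply: multipliers_intro => [k|v]; first by have := ta (inr k); lra.
  rewrite fE (@sum_subtype _ _ (active g p)); last first.
    by move=> i /negbTE ai; rewrite /ind ai oppr0 mul0r.
  rewrite -big_split/= -[RHS](mulr0 t) -[in RHS](Ea v) big_sumType/= [in RHS]addrC mulrDr !mulr_sumr.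
  congr (_ + _); apply: eq_bigr => k _; last by rewrite mulrA.
  have -> : ind (val k) = 1 by rewrite /ind; case: k => i /= ->.
  rewrite /dg /differential; ring.
have := in1; rewrite mlE /= => e1; have := in2; rewrite mlE /= -e1 => -[e2 e3].
have tn0 : t != 0 by rewrite gt_eqF.
case=> [j|k]; apply/eqP; rewrite -(mulrI_eq0 _ (mulfI tn0)).
  by have /rowP/(_ j) := e3; rewrite !mxE => ->.
have /rowP/(_ (val k)) := e2; rewrite extendT mxE.
have -> : ind (val k) = 1 by rewrite /ind; case: k => i /= ->.
by move=> /eqP; rewrite -subr_eq0 addrAC subrr add0r.
Qed.

End Multipliers.

Theorem theorem4p1 (R : realType) (n : nat) (M : smooth_manifold R n)
    (m q : nat) (g : C1map M m) (h : C1map M q) (p : M)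
    (hp : feasible g h p) :
  [/\ (* (a) *)
      (forall f : C1fun M, minimized_at g h p f -> multipliers g h f p !=set0)
        <-> GCQ g h p,
      (* (b) *)
      MFCQ g h p ->
        forall f : C1fun M, minimized_at g h p f ->
          compact (multipliers g h f p),
      (* (c) *)
      (exists f : C1fun M, [/\ minimized_at g h p f,
          multipliers g h f p !=set0 & compact (multipliers g h f p)]) ->
        MFCQ g h p &
      (* (d) *)
      (forall f : C1fun M, minimized_at g h p f ->
          exists ml, multipliers g h f p = [set ml])
        <-> LICQ g h p].
Proof.
have [c ac cp] := atlas_cover p.
have [T [TP Tsurj]] := tangent_param ac cp.
split.
- split; first by move=> H; exact: (multipliers_GCQ hp ac cp TP Tsurj H).
  by move=> gcq f; exact: (GCQ_multipliers hp TP Tsurj gcq).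
- by move=> mfcq f _; exact: (MFCQ_compact hp TP Tsurj mfcq).
- by move=> [f [_ ne cL]]; exact: (compact_MFCQ hp TP Tsurj ne cL).
- split; first by move=> H; exact: (unique_LICQ hp ac cp TP Tsurj H).
  move=> licq f fmin; have [ml Lml] := LICQ_multipliers hp ac cp TP Tsurj licq fmin.
  exists ml; apply/seteqP; split => [ml' Lml'|_ ->//].
  exact: (LICQ_unique hp Tsurj licq Lml' Lml).
Qed.
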